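(* Let $n\ge 1$ be an integer, $x\in\mathbb{R}$, and let $a=(a^{-1},a^0,\dots,a^n)\in \mathbb{C}^{n+2}$ where $a^{-1}\in\mathbb{R}$, $a^{-1} \le 0$ and $\operatorname{Im} a^0\geq 0$. Consider Problem $\partial CF\mathcal{P}$ with data $x$, $a$. (1) If $\rho(a)$ is finite and odd then Problem $\partial CF\mathcal{P}$ has no solution. (2) If $\rho(a) = 2m$ for some non-negative integer $m$ then Problem $\partial CF\mathcal{P}$ is solvable if and only if $H_m(a) > 0$ and $\operatorname{Im} a^{2m} > 0$. (3) If $\rho(a) = \infty$ and $n$ is odd, $n=2m-1$, then Problem $\partial CF\mathcal{P}$ is solvable if and only if the Hankel matrix $H_{m}(a)$ is either positive definite or SE-minimally positive. Moreover, the problem has a unique solution if and only if $H_m(a)$ is SE-minimally positive. (4) If $\rho(a) = \infty$ and $n$ is even, $n=2m$, then Problem $\partial CF\mathcal{P}$ is solvable if and only if either the Hankel matrix $H_{m}(a)$ is positive definite or both $H_{m}(a)$ is SE-minimally positive and $a^{n}$ satisfies $$ a^{n} = \begin{bmatrix} a^m & a^{m+1} & \dots & a^{m+r-1}\end{bmatrix} H_r(a)^{-1} \begin{bmatrix} a^{m+1} \\ a^{m+2}\\ \vdots \\ a^{m+r} \end{bmatrix} \qquad ( * ) $$ where $r=\operatorname{rank} H_m(a)$. Moreover, the problem has a unique solution if and only if $H_m(a)$ is SE-minimally positive and $a^{n}$ satisfies $( * )$.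
   Context: Superscripts on $a$ are indices, not powers. $\Pi=\{z\in\mathbb{C}:\operatorname{Im} z>0\}$. The Pick class $\mathcal{P}$ is the set of analytic functions $f$ on $\Pi$ with $\operatorname{Im} f\ge 0$ on $\Pi$. For $x\in\mathbb{R}$, $f\in\mathcal{P}$ is meromorphic at $x$ if $f$ extends to a function analytic in a deleted neighbourhood of $x$ in $\mathbb{C}$ having at most a pole at $x$. Problem $\partial CF\mathcal{P}$: given $x\in\mathbb{R}$, a non-negative integer $n$ and $a^{-1},a^0,\dots,a^n\in\mathbb{C}$, find $f\in\mathcal{P}$, meromorphic at $x$, such that $L_k(f,x)=a^k$ for $k=-1,0,1,\dots,n$, where $L_k(f,x)$ is the $k$th Laurent coefficient of $f$ at $x$. Such an $f$ is called a solution; the problem is solvable if it has at least one solution. $\rho(a)=\inf\{k\ge 0:\operatorname{Im} a^k\ne 0\}$, with $\rho(a)=\infty$ if all terms of $a$ are real. For a positive integer $m$ with $2m-1\le n$, $H_m(a)=[a^{i+j-1}]_{i,j=1}^m$. $M>0$ means positive definite; $M\ge 0$ (''positive'') means positive semi-definite. $H_m(a)$ is SE-minimally positive (southeast-minimally positive) if $H_m(a)\ge 0$ and, for every $\varepsilon>0$, $H_m(a)-\operatorname{diag}\{0,\dots,0,\varepsilon\}$ is not positive semi-definite. Conventions for empty matrices: for $m=0$ the condition $H_0(a)>0$ is vacuously true; for $r=0$ the right-hand side of $( * )$ is $0$. *)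

(* Defs.v *)
From HB Require Import structures.
From mathcomp Require Import all_boot all_order all_algebra.
From mathcomp Require Import all_classical all_reals all_analysis.
From mathcomp Require Import sesquilinear spectral complex.

Set Implicit Arguments.
Unset Strict Implicit.
Unset Printing Implicit Defensive.

Import Order.TTheory GRing.Theory Num.Theory.
Import numFieldNormedType.Exports.

Local Open Scope classical_set_scope.
Local Open Scope ring_scope.
Local Open Scope complex_scope.
Local Open Scope sesquilinear_scope.

(* The topology of R[i] is the one of its modulus, which any numFieldType
   carries on its regular module. *)
HB.instance Definition _ (R : rcfType) := PseudoPointedMetric.copy R[i] R[i]^o.
HB.instance Definition _ (R : rcfType) := GRing.ComAlgebra.copy R[i] R[i]^o.
HB.instance Definition _ (R : rcfType) := Vector.copy R[i] R[i]^o.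
HB.instance Definition _ (R : rcfType) := NormedModule.copy R[i] R[i]^o.

Definition upper_half_plane (R : realType) : set R[i] :=
  [set z | 0 < complex.Im z].

Definition analytic_at (R : realType) (F : R[i] -> R[i]) (z : R[i]) : Prop :=
  exists c : nat -> R[i],
    \forall w \near z, series (fun k => c k * (w - z) ^+ k) @ \oo --> F w.

(* A function f on the half-plane is represented by a total function, of which
   no notion about f below uses the values off the half-plane. Extensions of f
   across the real axis are denoted by F. *)
Definition pick_class (R : realType) (f : R[i] -> R[i]) : Prop :=
  forall z, upper_half_plane z -> analytic_at f z /\ 0 <= complex.Im (f z).

(* F(z) = \sum_(k >= -N) c_k (z - x)^k on a deleted neighbourhood of x, for
   some N: the principal part is finite, i.e. F has at most a pole at x. *)
Definition laurent_at (R : realType) (F : R[i] -> R[i]) (x : R[i])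
    (c : int -> R[i]) : Prop :=
  exists N : nat,
    (forall k : int, k < - N%:Z -> c k = 0) /\
    (\forall z \near x^',
       series (fun j : nat => c (j%:Z - N%:Z) * (z - x) ^ (j%:Z - N%:Z))
         @ \oo --> F z).

Definition laurent_expansion (R : realType) (f : R[i] -> R[i]) (x : R)
    (c : int -> R[i]) : Prop :=
  exists F : R[i] -> R[i],
    [/\ (forall z, upper_half_plane z -> F z = f z),
        (\forall z \near x%:C^', analytic_at F z)
      & laurent_at F x%:C c].

Definition meromorphic_at (R : realType) (f : R[i] -> R[i]) (x : R) : Prop :=
  exists c, laurent_expansion f x c.

(* L_k(f, x); the junk value 0 is taken when f is not meromorphic at x. *)
Definition laurent_coef (R : realType) (k : int) (f : R[i] -> R[i]) (x : R) :
    R[i] :=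
  xget 0 [set l | exists2 c, laurent_expansion f x c & c k = l].

(* The data (a^{-1}, a^0, ..., a^n) form a sequence whose entry number j
   (from 0) is a^{j-1}. *)
Definition solution (R : realType) (x : R) (a : seq R[i])
    (f : R[i] -> R[i]) : Prop :=
  [/\ pick_class f, meromorphic_at f x
    & forall j : nat, (j < size a)%N -> laurent_coef (j%:Z - 1) f x = a`_j].

Definition solvable (R : realType) (x : R) (a : seq R[i]) : Prop :=
  exists f, solution x a f.

Definition uniquely_solvable (R : realType) (x : R) (a : seq R[i]) : Prop :=
  exists2 f, solution x a f &
    forall g, solution x a g -> forall z, upper_half_plane z -> g z = f z.

(* a^k for k >= 0 *)
Definition term (R : realType) (a : seq R[i]) (k : nat) : R[i] := a`_k.+1.

(* None stands for infinity; a^{-1} is skipped. *)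
Definition rho (R : realType) (a : seq R[i]) : option nat :=
  let s := [seq complex.Im z != 0 | z <- behead a] in
  if has id s then Some (find id s) else None.

(* Indices start from 0, whence a^{(i+1)+(j+1)-1}. *)
Definition hankel (R : realType) (a : seq R[i]) (m : nat) : 'M[R[i]]_m :=
  \matrix_(i < m, j < m) term a (i + j).+1.

(* The order of R[i] is partial: 0 <= z means that z is real and nonnegative. *)
Definition posdef (R : realType) (m : nat) (M : 'M[R[i]]_m) : Prop :=
  M \is hermsymmx /\
  forall v : 'cV[R[i]]_m, v != 0 -> 0 < (v ^t* *m M *m v) 0 0.

Definition possemidef (R : realType) (m : nat) (M : 'M[R[i]]_m) : Prop :=
  M \is hermsymmx /\
  forall v : 'cV[R[i]]_m, 0 <= (v ^t* *m M *m v) 0 0.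

Definition SE_minimally_positive (R : realType) (m : nat) (M : 'M[R[i]]_m) :
    Prop :=
  possemidef M /\
  forall eps : R, 0 < eps ->
    ~ possemidef (M - diag_mx (\row_(j < m) if j.+1 == m then eps%:C else 0)).

(* The right-hand side of the formula for a^{2m}. *)
Definition hankel_extension (R : realType) (a : seq R[i]) (m : nat) : R[i] :=
  let r := \rank (hankel a m) in
  ((\row_(j < r) term a (m + j)) *m invmx (hankel a r)
     *m (\col_(i < r) term a (m + i).+1)) 0 0.

(* Main.v *)
Require Import Defs.
From mathcomp Require Import all_boot all_order all_algebra.
From mathcomp Require Import all_classical all_reals all_analysis.
From mathcomp Require Import sesquilinear spectral complex ring lra zify.
Import Order.TTheory GRing.Theory Num.Theory.
Import numFieldNormedType.Exports.
Local Open Scope ring_scope.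
Local Open Scope complex_scope.

(** The pole is split off first: f solves the problem iff f - a^{-1}/(z - x)
    solves the same problem with a^{-1} = 0. If a^0 is real, comparing leading
    terms at x shows that a solution has a^1 = 0 and is constant, or a^1 > 0.
    In the latter case Julia's reduction
      g = 1/(a^1 (z - x)) - 1/(f - a^0)
    is again in the Pick class, by a minimum principle for Im g, and all
    solutions f arise in this way from the solutions g of a problem with two
    coefficients less. On the Hankel matrices this reduction is the congruence
      H_{m+1}(a) = U (1/a^1 (+) H_m(b)) U^T, U lower triangular Toeplitz,
    which transports positivity and SE-minimality. The recursion ends with no
    or one real condition left (two solutions), with a^0 in the open upper
    half-plane (an explicit solution), or with a constant solution; the last
    case is the one of SE-minimality. *)

Set Implicit Arguments.
Unset Strict Implicit.
Unset Printing Implicit Defensive.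

(** Nothing is known about f on the real axis away from x, so positivity of Im g cannot be checked
    there. What makes the reduction work is the bound Im g >= Im (1/(z - x)) / a^1, a consequence of
    Im f >= 0: its right-hand side tends to 0 at infinity and at every real point other than x. At x
    itself Im g tends to Im a^2 / (a^1)^2. That this is not negative is invisible along rays, where
    the term in a^1 dominates, and requires an approach tangent to the real axis. Removing the pole
    rests on the same principle, with the bound - a^{-1} Im (1/(z - x)). Coefficients are infinite
    sequences of which a prefix is prescribed, so that one relation [schur_rel] serves functions,
    data and Hankel matrices. The rank formula for a^{2m} is not visibly invariant under the
    reduction. It is replaced by the inductive predicate [degenerate], which is, and the two are
    compared separately by linear algebra. *)

Local Notation modulus := Normc.normc.
Local Notation Re := complex.Re.
Local Notation Im := complex.Im.

(** * The modulus of complex numbers and the topology it defines *)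

Section Modulus.
Variable R : realType.
Implicit Types (z w t u : R[i]) (s e : R).

Lemma normr_modulus z : `|z| = (modulus z)%:C.
Proof. by case: z. Qed.

Lemma modulus_ge0 z : 0 <= modulus z.
Proof. by case: z => a b /=; exact: sqrtr_ge0. Qed.

Lemma modulusD z w : modulus (z + w) <= modulus z + modulus w.
Proof. exact: le_normcD. Qed.

Lemma modulusN z : modulus (- z) = modulus z.
Proof. exact: normcN. Qed.

Lemma modulusB z w : modulus (z - w) <= modulus z + modulus w.
Proof. by rewrite -(modulusN w); exact: modulusD. Qed.

Lemma modulus_distC z w : modulus (z - w) = modulus (w - z).
Proof. by rewrite -modulusN opprB. Qed.

Lemma modulusM z w : modulus (z * w) = modulus z * modulus w.
Proof. exact: Normc.normcM. Qed.

Lemma modulusX z n : modulus (z ^+ n) = modulus z ^+ n.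
Proof.
by elim: n => [|n IH]; [exact: Normc.normc1|rewrite !exprS modulusM IH].
Qed.

Lemma modulusV z : modulus z^-1 = (modulus z)^-1.
Proof. exact: Normc.normcV. Qed.

Lemma modulus_real s : modulus (s%:C) = `|s|.
Proof. by rewrite /= expr0n addr0 sqrtr_sqr. Qed.

Lemma modulus0 : modulus (0 : R[i]) = 0.
Proof. exact: Normc.normc0. Qed.

Lemma modulus1 : modulus (1 : R[i]) = 1.
Proof. exact: Normc.normc1. Qed.

Lemma modulus_eq0 z : (modulus z == 0) = (z == 0).
Proof. by apply/eqP/eqP => [/Normc.eq0_normc //|->]; exact: modulus0. Qed.

Lemma modulus_gt0 z : (0 < modulus z) = (z != 0).
Proof. by rewrite lt_neqAle modulus_ge0 andbT eq_sym modulus_eq0. Qed.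

Lemma modulus_sqr z : modulus z ^+ 2 = Re z ^+ 2 + Im z ^+ 2.
Proof. by case: z => a b /=; rewrite sqr_sqrtr // addr_ge0 ?sqr_ge0. Qed.

Lemma Im_le_modulus z : `|Im z| <= modulus z.
Proof.
rewrite -(ler_pXn2r (n := 2)) ?nnegrE ?modulus_ge0//.
by rewrite modulus_sqr real_normK ?num_real// lerDr sqr_ge0.
Qed.

Lemma Re_le_modulus z : `|Re z| <= modulus z.
Proof.
rewrite -(ler_pXn2r (n := 2)) ?nnegrE ?modulus_ge0//.
by rewrite modulus_sqr real_normK ?num_real// lerDl sqr_ge0.
Qed.

Lemma modulus_le_ReIm z : modulus z <= `|Re z| + `|Im z|.
Proof.
rewrite -(ler_pXn2r (n := 2)) ?nnegrE ?modulus_ge0 ?addr_ge0//.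
rewrite modulus_sqr -(real_normK (num_real (Re z))).
rewrite -(real_normK (num_real (Im z))) sqrrD addrAC lerDl.
by rewrite mulrn_wge0// mulr_ge0.
Qed.

Lemma modulus_sum n (F : 'I_n -> R[i]) :
  modulus (\sum_(i < n) F i) <= \sum_(i < n) modulus (F i).
Proof.
elim/big_ind2: _ => [|x1 x2 y1 y2 h1 h2|//]; first by rewrite modulus0.
by rewrite (le_trans (modulusD _ _))// lerD.
Qed.

Lemma Re_add z w : Re (z + w) = Re z + Re w.
Proof. by case: z w => ? ? []. Qed.
Lemma Im_add z w : Im (z + w) = Im z + Im w.
Proof. by case: z w => ? ? []. Qed.
Lemma Re_opp z : Re (- z) = - Re z.
Proof. by case: z. Qed.
Lemma Im_opp z : Im (- z) = - Im z.
Proof. by case: z. Qed.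
Lemma Re_mul z w : Re (z * w) = Re z * Re w - Im z * Im w.
Proof. by case: z w => ? ? []. Qed.
Lemma Im_mul z w : Im (z * w) = Re z * Im w + Im z * Re w.
Proof. by case: z w => ? ? []. Qed.
Lemma Re_inv z : Re z^-1 = Re z / modulus z ^+ 2.
Proof. by rewrite modulus_sqr; case: z. Qed.
Lemma Im_inv z : Im z^-1 = - Im z / modulus z ^+ 2.
Proof. by rewrite modulus_sqr; case: z => ? ?; rewrite mulNr. Qed.
Lemma Im_scale s z : Im (s%:C * z) = s * Im z.
Proof. by rewrite Im_mul /= mul0r addr0. Qed.

Lemma eq_ReIm z w : Re z = Re w -> Im z = Im w -> z = w.
Proof. by case: z w => ? ? [] ? ? /= -> ->. Qed.

Lemma real_of_Im0 z : Im z = 0 -> z = (Re z)%:C.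
Proof. by case: z => a b /= ->. Qed.

Local Open Scope classical_set_scope.

Lemma near_modulusP z (P : R[i] -> Prop) :
  (\forall w \near z, P w) <->
  exists2 e : R, 0 < e & forall w, modulus (w - z) < e -> P w.
Proof.
split=> [/nbhs_normP[e /= e0 H]|[e e0 H]].
  (* The radius ranges over positive elements of [R[i]], which the order forces to be real. *)
  have eR : e = (Re e)%:C by apply: real_of_Im0; exact: ger0_Im (ltW e0).
  exists (Re e) => [|w hw]; first by rewrite -ltcR -eR.
  by apply: H; rewrite /= normr_modulus eR ltcR modulus_distC.
apply/nbhs_normP; exists e%:C => /=; first by rewrite ltcR.
by move=> w /=; rewrite normr_modulus ltcR modulus_distC; exact: H.
Qed.

Lemma dnear_modulusP z (P : R[i] -> Prop) :
  (\forall w \near z^', P w) <->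
  exists2 e : R, 0 < e & forall w, w != z -> modulus (w - z) < e -> P w.
Proof.
split=> [/near_modulusP[e e0 H]|[e e0 H]].
  by exists e => // w wz we; exact: (H w).
by apply/near_modulusP; exists e => // w we wz; exact: H.
Qed.

Lemma cvg_modulusP (v : nat -> R[i]) z : v @ \oo --> z <->
  forall e : R, 0 < e -> exists n0, forall n, (n0 <= n)%N -> modulus (v n - z) < e.
Proof.
split=> [/cvgrPdist_lt H e e0|H].
  have [|n0 _ h] := H e%:C; first by rewrite ltcR.
  exists n0 => n hn; move: (h n hn).
  by rewrite /= normr_modulus ltcR modulus_distC.
apply/cvgrPdist_lt => e e0.
have eR : e = (Re e)%:C by apply: real_of_Im0; exact: ger0_Im (ltW e0).
have [|n0 h] := H (Re e); first by rewrite -ltcR -eR.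
exists n0 => // n hn /=; rewrite normr_modulus eR ltcR modulus_distC.
exact: h.
Qed.

End Modulus.

(** * Convergent power series and coefficient bounds *)

Section PowerSeries.
Variable R : realType.
Implicit Types (z w t u y : R[i]) (c d : nat -> R[i]) (A r e : R).
Local Open Scope classical_set_scope.

Definition ps c t n := \sum_(k < n) c k * t ^+ k.

(* A record rather than a plain definition, which would unfold to a
   quantification when implicit arguments are computed. *)
Record psum c t y : Prop := Psum { cvg_ps : ps c t @ \oo --> y }.

Lemma psS c t n : ps c t n.+1 = ps c t n + c n * t ^+ n.
Proof. by rewrite /ps big_ord_recr. Qed.

Lemma psumE c t y : psum c t y = (ps c t @ \oo --> y).
Proof. by apply/propext; split=> [[]|]. Qed.

Lemma psum_seriesE c t y :
  psum c t y = (series (fun k => c k * t ^+ k) @ \oo --> y).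
Proof.
rewrite psumE (_ : series _ = ps c t)//.
by apply/funext => n; rewrite /series /= big_mkord.
Qed.

Lemma psum_unique c t y y' : psum c t y -> psum c t y' -> y = y'.
Proof. by move=> [h] [h']; apply: (cvg_unique _ h h'). Qed.

Lemma eq_psum c d t y : c =1 d -> psum c t y -> psum d t y.
Proof. by move=> /funext ->. Qed.

Lemma psum_at0 c : psum c 0 (c 0%N).
Proof.
rewrite psumE; apply/cvg_modulusP => e e0; exists 1%N => -[//|n] _.
rewrite /ps big_ord_recl expr0 mulr1 big1 ?addr0 ?subrr ?modulus0// => i _.
by rewrite expr0n mulr0.
Qed.

Lemma psum_cst y t : psum (fun k => if k == 0%N then y else 0) t y.
Proof.
rewrite psumE; apply/cvg_modulusP => e e0; exists 1%N => -[//|n] _.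
rewrite /ps big_ord_recl expr0 mulr1 big1 ?addr0 ?subrr ?modulus0// => i _.
by rewrite mul0r.
Qed.

Lemma psumD c d t y y' :
  psum c t y -> psum d t y' -> psum (fun k => c k + d k) t (y + y').
Proof.
rewrite !psumE => hc hd.
suff -> : ps (fun k => c k + d k) t = (fun n => ps c t n + ps d t n).
  exact: (cvgD hc hd).
apply/funext => n; rewrite /ps -big_split/=; apply: eq_bigr => i _.
by rewrite mulrDl.
Qed.

Lemma psumZ s c t y : psum c t y -> psum (fun k => s * c k) t (s * y).
Proof.
rewrite !psumE => hc.
suff -> : ps (fun k => s * c k) t = (fun n => s * ps c t n).
  exact: (cvgM (cvg_cst s) hc).
apply/funext => n; rewrite /ps mulr_sumr; apply: eq_bigr => i _.
by rewrite mulrA.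
Qed.

Lemma psumN c t y : psum c t y -> psum (fun k => - c k) t (- y).
Proof.
move=> /(@psumZ (-1)); rewrite mulN1r.
by apply: eq_psum => k; rewrite mulN1r.
Qed.

Definition shiftseq c k := if k is k'.+1 then c k' else 0.

Lemma ps_shift c t n : ps (shiftseq c) t n.+1 = t * ps c t n.
Proof.
rewrite /ps big_ord_recl mul0r add0r mulr_sumr; apply: eq_bigr => i _.
by rewrite /= exprS mulrCA.
Qed.

Lemma psum_shift c t y : psum c t y -> psum (shiftseq c) t (t * y).
Proof.
rewrite !psumE => hc; rewrite -cvg_shiftS.
rewrite (_ : [sequence _]_n = (fun n => t * ps c t n)).
  exact: (cvgM (cvg_cst t) hc).
by apply/funext => n; rewrite /= ps_shift.
Qed.

Lemma psum_unshift c t y : t != 0 ->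
  psum c t y -> psum (fun k => c k.+1) t ((y - c 0%N) / t).
Proof.
rewrite !psumE => t0 hc; rewrite -cvg_shiftS in hc.
rewrite (_ : ps _ t = (fun n => (ps c t n.+1 - c 0%N) / t)).
  exact: (cvgM (cvgB hc (cvg_cst _)) (cvg_cst _)).
apply/funext => n; rewrite {2}/ps big_ord_recl expr0 mulr1 addrC addKr.
rewrite mulr_suml; apply: eq_bigr => i _.
by rewrite /= exprSr mulrA mulfK.
Qed.

Lemma psum_unshiftn K c t y : t != 0 -> psum c t y ->
  psum (fun k => c (K + k)%N) t ((y - ps c t K) / t ^+ K).
Proof.
move=> t0 hc; elim: K => [|K IH].
  by rewrite /ps big_ord0 subr0 expr0 divr1.
have := psum_unshift t0 IH; rewrite addn0 => h.
rewrite (_ : _ / _ = ((y - ps c t K) / t ^+ K - c K) / t); last first.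
  by rewrite psS exprS; field; rewrite t0 expf_neq0.
by apply: eq_psum h => k; rewrite addnS addSn.
Qed.

Definition geo_bounded A r c := forall k, modulus (c k) <= A * r ^+ k.

Lemma geo_ge0 A r c : geo_bounded A r c -> 0 <= A.
Proof. by move=> /(_ 0%N); rewrite expr0 mulr1; apply: le_trans (modulus_ge0 _). Qed.

(** The terms of a convergent series are bounded: from [n0] on by 2, as differences of partial sums
    within 1 of the limit, and before that by the sum of their moduli. Dividing by |t|^k gives the
    rate 1/|t|. *)
Lemma psum_geo c t y : t != 0 -> psum c t y ->
  exists A r, 0 < r /\ geo_bounded A r c.
Proof.
move=> t0; rewrite psumE => /cvg_modulusP /(_ 1 ltr01)[n0 hn].
exists (2 + \sum_(k < n0) modulus (c k * t ^+ k)), (modulus t)^-1.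
split=> [|k]; first by rewrite invr_gt0 modulus_gt0.
have tk0 : 0 < modulus t ^+ k by rewrite exprn_gt0 ?modulus_gt0.
rewrite exprVn ler_pdivlMr// -modulusX -modulusM.
case: (ltnP k n0) => kn.
  rewrite (bigD1 (Ordinal kn))//= addrCA lerDl addr_ge0//.
  by rewrite sumr_ge0 // => i _; exact: modulus_ge0.
have -> : c k * t ^+ k = (ps c t k.+1 - y) - (ps c t k - y).
  by rewrite psS; ring.
apply: (le_trans (modulusB _ _)); rewrite ler_wpDr//.
  by rewrite sumr_ge0 // => i _; exact: modulus_ge0.
by have := hn k kn; have := hn k.+1 (leqW kn); lra.
Qed.

(** Comparison with a geometric series of ratio at most 1/2, whose sum gives the factor 2. The
    finite sums satisfy the bound with a deficit (1/2)^m, which makes the induction work; the limit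
    is taken last. *)
Lemma psum_tail A r c t y K : geo_bounded A r c -> 0 <= r -> psum c t y ->
  r * modulus t <= 1/2 -> modulus (y - ps c t K) <= 2 * A * (r * modulus t) ^+ K.
Proof.
move=> gc r0 hc rt.
have q0 : 0 <= r * modulus t by rewrite mulr_ge0 ?modulus_ge0.
have A0 := geo_ge0 gc.
set q := r * modulus t in rt q0 *.
have Hm m : modulus (ps c t (K + m) - ps c t K) <= 2 * A * q ^+ K * (1 - (1/2)^+ m).
  elim: m => [|m IH]; first by rewrite addn0 !subrr modulus0 mulr0.
  rewrite addnS psS addrAC.
  apply: (le_trans (modulusD _ _)).
  have : modulus (c (K + m)%N * t ^+ (K + m)) <= A * q ^+ K * (1/2) ^+ m.
    rewrite modulusM modulusX.
    apply: (@le_trans _ _ (A * q ^+ (K + m))).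
      by rewrite /q exprMn mulrA ler_wpM2r ?exprn_ge0 ?modulus_ge0.
    by rewrite exprD mulrA ler_wpM2l ?mulr_ge0 ?exprn_ge0// lerXn2r ?nnegrE//; lra.
  rewrite exprS; move: IH; set X := A * q ^+ K.
  rewrite -!(mulrA 2 A) -/X; set Y := (1/2)^+m.
  lra.
rewrite psumE in hc; apply/ler_addgt0Pl => e e0.
have [n0 hn] := (cvg_modulusP _ _).1 hc e e0.
have := hn (K + n0)%N (leq_addl _ _).
have := Hm n0.
have : 2 * A * q ^+ K * (1 - (1/2) ^+ n0) <= 2 * A * q ^+ K.
  by rewrite ler_piMr ?mulr_ge0 ?exprn_ge0//.
have := modulusD (y - ps c t (K + n0)) (ps c t (K + n0) - ps c t K).
rewrite addrA subrK (modulus_distC y (ps c t (K + n0))).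
lra.
Qed.

End PowerSeries.

(** * Products and inverses of power series *)

Section CauchyProduct.
Variable R : realType.
Implicit Types (z w t u y : R[i]) (c d : nat -> R[i]) (A B r e : R).
Local Open Scope classical_set_scope.

Definition convseq c d k := \sum_(i < k.+1) c i * d (k - i)%N.

Lemma geoW A r r' c : geo_bounded A r c -> 0 <= r -> r <= r' -> geo_bounded A r' c.
Proof.
move=> gc r0 rr k; apply: (le_trans (gc k)).
by rewrite ler_wpM2l ?(geo_ge0 gc)// lerXn2r ?nnegrE// (le_trans r0).
Qed.

(** Write 1/8 = (1/2)^3 and use n (1/2)^n <= 1 twice. The factor n^2 counts the error terms of a
    Cauchy product. *)
Lemma sqr_expn8_le n : n%:R ^+ 2 * (1/8) ^+ n <= (1/2 : R) ^+ n.
Proof.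
have -> : (1/8 : R) = (1/2) ^+ 3 by rewrite !exprS expr0; lra.
rewrite -exprM mulnC exprM.
have h : n%:R * (1/2 : R) ^+ n <= 1.
  rewrite div1r exprVn ler_pdivrMr ?exprn_gt0// mul1r -natrX ler_nat.
  exact/ltnW/ltn_expl.
have p0 : 0 <= (1/2 : R) ^+ n by rewrite exprn_ge0//; lra.
have p1 : 0 <= n%:R * (1/2 : R) ^+ n by rewrite mulr_ge0.
rewrite (_ : _ * _ = (n%:R * (1 / 2) ^+ n) ^+ 2 * (1 / 2) ^+ n); last by ring.
by rewrite ler_piMl// exprn_ile1.
Qed.

Lemma half_exp_cvg e : 0 < e -> exists n0, forall n, (n0 <= n)%N ->
  (1/2 : R) ^+ n < e.
Proof.
move=> e0; have /cvgrPdist_lt/(_ e e0)[n0 _ h] : (1/2 : R) ^+ n @[n --> \oo] --> 0.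
  by apply: cvg_expr; rewrite ger0_norm; lra.
exists n0 => n /h; rewrite /= sub0r normrN ger0_norm// exprn_ge0//; lra.
Qed.

(** With both series cut to polynomials of degree below n, the error is the sum of the coefficients
    n, ..., 2n-1 of their product. Each of these n coefficients has at most 2n terms, bounded by A B
    q^n with q = r|t| <= 1/8, so the factor n^2 is absorbed. *)
Lemma cauchy_diff A B r c d t : geo_bounded A r c -> geo_bounded B r d -> 0 <= r ->
  r * modulus t <= 1/8 ->
  (fun n => ps c t n * ps d t n - ps (convseq c d) t n) @ \oo --> (0 : R[i]).
Proof.
move=> gc gd r0 rt; have A0 := geo_ge0 gc; have B0 := geo_ge0 gd.
have q0 : 0 <= r * modulus t by rewrite mulr_ge0 ?modulus_ge0.
set q := r * modulus t in rt q0.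
have Hn n : modulus (ps c t n * ps d t n - ps (convseq c d) t n) <=
    2 * (A * B) * (1/2) ^+ n.
  pose p := \poly_(k < n) (c k * t ^+ k); pose p' := \poly_(k < n) (d k * t ^+ k).
  have hp : ps c t n = p.[1].
    by rewrite horner_poly; apply: eq_bigr => i _; rewrite expr1n mulr1.
  have hp' : ps d t n = p'.[1].
    by rewrite horner_poly; apply: eq_bigr => i _; rewrite expr1n mulr1.
  have -> : ps c t n * ps d t n - ps (convseq c d) t n =
      \sum_(k < n) (p * p')`_(n + k).
    rewrite hp hp' -hornerM (@horner_coef_wide _ (n + n)); last first.
      rewrite (leq_trans (size_polyMleq _ _))// (leq_trans (leq_pred _))//.
      by rewrite leq_add// size_poly.
    rewrite big_split_ord /= addrAC -[RHS]add0r; congr (_ + _); last first.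
      by apply: eq_bigr => i _; rewrite expr1n mulr1.
    rewrite /ps -sumrB big1// => i _; rewrite expr1n mulr1 coefM.
    rewrite /convseq mulr_suml -sumrB big1// => j _.
    have ji : (j <= i)%N by rewrite -ltnS.
    rewrite !coef_poly (leq_ltn_trans ji)// (leq_ltn_trans (leq_subr _ _))//.
    have -> : t ^+ i = t ^+ j * t ^+ (i - j) by rewrite -exprD subnKC.
    by ring.
  apply: (le_trans (modulus_sum _)).
  have Hk (k : 'I_n) : modulus (p * p')`_(n + k) <= (2 * n)%:R * (A * B * q ^+ n).
    rewrite coefM; apply: (le_trans (modulus_sum _)).
    have hj (j : 'I_(n + k).+1) : modulus (p`_j * p'`_(n + k - j)) <= A * B * q ^+ n.
      have X0 : 0 <= A * B * q ^+ n by rewrite !mulr_ge0// exprn_ge0.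
      rewrite !coef_poly; case: ifP => jn; last by rewrite mul0r modulus0.
      case: ifP => kn; last by rewrite mulr0 modulus0.
      have jk : (j <= n + k)%N by rewrite -ltnS.
      rewrite !modulusM !modulusX.
      apply: (@le_trans _ _ ((A * q ^+ j) * (B * q ^+ (n + k - j)))).
        apply: ler_pM; rewrite ?mulr_ge0 ?modulus_ge0 ?exprn_ge0 ?modulus_ge0//.
          by rewrite /q exprMn mulrA ler_wpM2r ?exprn_ge0 ?modulus_ge0.
        by rewrite /q exprMn mulrA ler_wpM2r ?exprn_ge0 ?modulus_ge0.
      rewrite mulrACA -exprD subnKC// ler_wpM2l ?mulr_ge0//.
      by rewrite exprD ler_piMr ?exprn_ge0// exprn_ile1//; lra.
    apply: (le_trans (ler_sum _ (fun j _ => hj j))).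
    rewrite sumr_const card_ord -[X in X <= _]mulr_natl ler_wpM2r ?mulr_ge0 ?exprn_ge0//.
    by rewrite ler_nat; move: (ltn_ord k); lia.
  apply: (le_trans (ler_sum _ (fun k _ => Hk k))).
  rewrite sumr_const card_ord -[X in X <= _]mulr_natl natrM.
  have := sqr_expn8_le n.
  have : q ^+ n <= (1/8) ^+ n by rewrite lerXn2r ?nnegrE//; lra.
  have : 0 <= A * B by rewrite mulr_ge0.
  have : 0 <= (n%:R : R) by [].
  move: (q ^+ n) ((1/8) ^+ n) ((1/2) ^+ n) (n%:R : R) (A * B) => x y z m C m0 C0 h1 h2.
  have : m ^+ 2 * x <= z by apply: le_trans h2; rewrite ler_wpM2l// sqr_ge0.
  move=> h; rewrite (_ : m * _ = 2 * C * (m ^+ 2 * x)); last by ring.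
  by rewrite ler_wpM2l// mulr_ge0.
apply/cvg_modulusP => e e0.
have [|n0 h] := @half_exp_cvg (e / (2 * (A * B) + 1)).
  by rewrite divr_gt0//; have := mulr_ge0 A0 B0; lra.
exists n0 => n /h; rewrite ltr_pdivlMr; last by have := mulr_ge0 A0 B0; lra.
have := Hn n; rewrite subr0.
have : 0 <= (1/2 : R) ^+ n by rewrite exprn_ge0//; lra.
rewrite mulrDr mulr1 (mulrC (_ ^+ n)); lra.
Qed.

Lemma psumM A B r c d t y y' : geo_bounded A r c -> geo_bounded B r d -> 0 <= r ->
  r * modulus t <= 1/8 -> psum c t y -> psum d t y' ->
  psum (convseq c d) t (y * y').
Proof.
move=> gc gd r0 rt; rewrite !psumE => hc hd.
rewrite (_ : ps (convseq c d) t = (fun n => ps c t n * ps d t n -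
  (ps c t n * ps d t n - ps (convseq c d) t n))); last first.
  by apply/funext => n; ring.
rewrite -[y * y']subr0.
exact: (cvgB (cvgM hc hd) (cauchy_diff gc gd r0 rt)).
Qed.

(** Course-of-values recursion: [F m] unfolds to depth m and is already final below m, since [G n]
    reads only values below n. *)
Lemma strong_rec (T : Type) (x0 : T) (G : nat -> (nat -> T) -> T) :
  (forall n f g, (forall i, (i < n)%N -> f i = g i) -> G n f = G n g) ->
  exists f, forall n, f n = G n f.
Proof.
move=> hG; pose F := fix F m := if m is m'.+1 then fun n => G n (F m') else fun=> x0.
have FE n : forall m m', (n < m)%N -> (n < m')%N -> F m n = F m' n.
  elim/ltn_ind: n => n IH [//|m] [//|m']; rewrite !ltnS => nm nm' /=.
  by apply: hG => i im; apply: IH => //; exact: leq_trans im _.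
exists (fun n => F n.+1 n) => n /=; apply: hG => i im.
exact: (FE i n i.+1).
Qed.

(** The rate is chosen so that the induction closes: with q = A/|c_0|, the recursion for d_(k+1)
    produces q times the sum of (1+q)^j over j <= k, which telescopes to (1+q)^(k+1) - 1. *)
Lemma geo_inverse A r c d : 0 <= r -> c 0%N != 0 -> geo_bounded A r c ->
  (forall k, convseq c d k = if k == 0%N then 1 else 0) ->
  geo_bounded (modulus (c 0%N))^-1 (r * (1 + A / modulus (c 0%N))) d.
Proof.
move=> r0 c0 gc hd.
have m0 : 0 < modulus (c 0%N) by rewrite modulus_gt0.
have A0 := geo_ge0 gc.
set m := modulus _ in m0 *; set s := r * _.
have q0 : 0 <= A / m by rewrite divr_ge0// ltW.
elim/ltn_ind => -[|k] IH.
  have := hd 0%N; rewrite /convseq big_ord1 subn0/= => h.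
  have -> : d 0%N = (c 0%N)^-1 by apply: (mulfI c0); rewrite h divff.
  by rewrite modulusV expr0 mulr1.
have := hd k.+1; rewrite /convseq big_ord_recl subn0/= => /eqP.
rewrite addr_eq0 => /eqP h.
rewrite -(ler_pM2l m0) -modulusM h modulusN mulrA divff ?gt_eqF// mul1r.
apply: (le_trans (modulus_sum _)).
apply: (@le_trans _ _ (\sum_(i < k.+1) (A * r ^+ i.+1 * (m^-1 * s ^+ (k - i))))).
  apply: ler_sum => i _; rewrite modulusM /bump/= add1n subSS.
  by apply: ler_pM; rewrite ?modulus_ge0//; apply: IH; rewrite ltnS leq_subr.
have -> : \sum_(i < k.+1) (A * r ^+ i.+1 * (m^-1 * s ^+ (k - i))) =
   r ^+ k.+1 * ((A / m) * \sum_(i < k.+1) (1 + A / m) ^+ (k - i)).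
  rewrite !mulr_sumr; apply: eq_bigr => i _.
  have ik : (i <= k)%N by rewrite -ltnS.
  have -> : r ^+ k.+1 = r ^+ i.+1 * r ^+ (k - i) by rewrite -exprD addSn subnKC.
  by rewrite /s exprMn; ring.
rewrite /s exprMn ler_wpM2l ?exprn_ge0//.
have -> : A / m * \sum_(i < k.+1) (1 + A / m) ^+ (k - i) = (1 + A / m) ^+ k.+1 - 1.
  have := subrXX (1 + A / m) 1 k.+1; rewrite expr1n => ->.
  congr (_ * _); first by rewrite addrC addKr.
  by apply: eq_bigr => i _; rewrite expr1n mulr1.
lra.
Qed.

Lemma inverse_exists c : c 0%N != 0 ->
  exists d, forall k, convseq c d k = if k == 0%N then 1 else 0.
Proof.
move=> c0.
pose G k (d : nat -> R[i]) := if k is k'.+1 then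
  - (\sum_(i < k'.+1) c i.+1 * d (k' - i)%N) / c 0%N else (c 0%N)^-1.
have [|d hd] := @strong_rec _ 0 G.
  move=> [//|n] f g fg; rewrite /G; congr (- _ / _); apply: eq_bigr => i _.
  by rewrite fg// ltnS leq_subr.
exists d => -[|k]; first by rewrite /convseq big_ord1 subn0 hd /= divff.
rewrite /convseq big_ord_recl subn0 {1}hd /= mulrCA mulfV// mulr1.
by apply/eqP; rewrite addrC addr_eq0 opprK; apply/eqP/eq_bigr => i _; rewrite subSS.
Qed.

(** Convergence of the series of d is part of the conclusion. The products of partial sums tend to 1
    by [cauchy_diff], and they can be divided by the partial sums of c, which are eventually nonzero
    because y is. *)
Lemma psumV A B r c d t y : geo_bounded A r c -> geo_bounded B r d -> 0 <= r ->
  r * modulus t <= 1/8 ->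
  (forall k, convseq c d k = if k == 0%N then 1 else 0) ->
  psum c t y -> y != 0 -> psum d t y^-1.
Proof.
move=> gc gd r0 rt cd hc y0.
have h1 : psum (convseq c d) t 1.
  have -> : convseq c d = (fun k => if k == 0%N then 1 else 0) by apply/funext.
  exact: psum_cst.
rewrite !psumE in hc h1 *.
have h2 : (fun n => ps c t n * ps d t n) @ \oo --> (1 : R[i]).
  rewrite -[1]add0r (_ : (fun _ => _) = (fun n =>
    (ps c t n * ps d t n - ps (convseq c d) t n) + ps (convseq c d) t n)).
    exact: cvgD (cauchy_diff gc gd r0 rt) h1.
  by apply/funext => n; rewrite subrK.
have h3 : (fun n => ps c t n * ps d t n * (ps c t n)^-1) @ \oo --> y^-1.
  by rewrite -[y^-1]mul1r; exact: cvgM h2 (cvgV y0 hc).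
apply: cvg_trans h3; apply: near_eq_cvg.
have [n0 hn] := (cvg_modulusP _ _).1 hc (modulus y) (etrans (modulus_gt0 y) y0).
exists n0 => // n /= /hn hy; rewrite mulrAC mulfV ?mul1r//.
apply: contraTneq hy => ->; by rewrite sub0r modulusN ltxx.
Qed.

Lemma geo_both c d A r B s : 0 <= r -> 0 <= s -> geo_bounded A r c -> geo_bounded B s d ->
  geo_bounded A (r + s) c /\ geo_bounded B (r + s) d.
Proof. by move=> *; split; [apply: geoW; eauto; lra | apply: geoW; eauto; lra]. Qed.

End CauchyProduct.

(** * Expansions on punctured discs and their leading terms *)

Section PuncturedExpansion.
Variable R : realType.
Implicit Types (z w t u y : R[i]) (c d : nat -> R[i]) (A B r e s : R).
Implicit Types (f g : R[i] -> R[i]) (D : R[i] -> Prop).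
Local Open Scope classical_set_scope.

(* The value at 0 is left out, as f may be an expression with the junk value of
   a division by 0 there. *)
Definition expands c f :=
  exists2 e : R, 0 < e & forall t, t != 0 -> modulus t < e -> psum c t (f t).

Lemma eq_expands c f g : (exists2 e : R, 0 < e &
    forall t, t != 0 -> modulus t < e -> f t = g t) ->
  expands c f -> expands c g.
Proof.
move=> [e e0 he] [e' e'0 he']; exists (Num.min e e'); first by rewrite lt_min e0.
by move=> t t0; rewrite lt_min => /andP[h h']; rewrite -he//; exact: he'.
Qed.

Lemma analytic_atP f z : analytic_at f z <->
  exists2 c, c 0%N = f z & expands c (fun t => f (z + t)).
Proof.
split=> [[c /near_modulusP[e e0 H]]|[c cz [e e0 H]]].
  have {}H w : modulus (w - z) < e -> psum c (w - z) (f w).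
    by rewrite psum_seriesE; exact: H.
  exists c.
    have := H z; rewrite subrr modulus0 => /(_ e0) h.
    exact: psum_unique (psum_at0 c) h.
  by exists e => // t t0 te; have := H (z + t); rewrite (addrC z t) addrK; apply.
exists c; apply/near_modulusP; exists e => // w we; rewrite -psum_seriesE.
have [->|wz] := eqVneq w z; first by rewrite subrr -cz; exact: psum_at0.
have := H (w - z); rewrite subr_eq0 => /(_ wz we).
by rewrite (addrC z) subrK.
Qed.

Lemma small_nonzero e : 0 < e -> exists2 t, t != 0 & modulus t < e.
Proof.
move=> e0; exists (e / 2)%:C; last by rewrite modulus_real ger0_norm; lra.
by rewrite -modulus_gt0 modulus_real ger0_norm; lra.
Qed.

Lemma expands_geo c f : expands c f -> exists A r, 0 < r /\ geo_bounded A r c.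
Proof.
by move=> [e /small_nonzero[t t0 te] H]; exact: psum_geo t0 (H t t0 te).
Qed.

Lemma small_radius r q : 0 <= r -> 0 < q -> exists2 e, 0 < e &
  forall t, modulus t < e -> r * modulus t <= q.
Proof.
move=> r0 q0; exists (q / (r + 1)); first by rewrite divr_gt0//; lra.
move=> t; rewrite ltr_pdivlMr; last by lra.
by have := modulus_ge0 t; rewrite mulrDr mulr1 mulrC; lra.
Qed.

Lemma expands_bound K c f : expands c f -> exists B e, [/\ 0 <= B, 0 < e &
  forall t, t != 0 -> modulus t < e ->
    modulus (f t - ps c t K) <= B * modulus t ^+ K].
Proof.
move=> hf; have [A [r [r0 gc]]] := expands_geo hf; have A0 := geo_ge0 gc.
have [e e0 H] := hf; have [||e' e'0 H'] := @small_radius r (1/2); [lra|lra|].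
exists (2 * A * r ^+ K), (Num.min e e'); split.
- by rewrite !mulr_ge0// exprn_ge0// ltW.
- by rewrite lt_min e0.
move=> t t0; rewrite lt_min => /andP[te te'].
by rewrite -mulrA -exprMn; apply: psum_tail gc (ltW r0) (H t t0 te) (H' t te').
Qed.

Lemma expands_cst y : expands (fun k => if k == 0%N then y else 0) (fun=> y).
Proof. by exists 1 => // t _ _; exact: psum_cst. Qed.

Lemma expandsD c d f g : expands c f -> expands d g ->
  expands (fun k => c k + d k) (fun t => f t + g t).
Proof.
move=> [e e0 h] [e' e'0 h']; exists (Num.min e e'); first by rewrite lt_min e0.
by move=> t t0; rewrite lt_min => /andP[te te']; exact: psumD (h t t0 te) (h' t t0 te').
Qed.

Lemma expandsZ y c f : expands c f -> expands (fun k => y * c k) (fun t => y * f t).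
Proof. by move=> [e e0 h]; exists e => // t t0 te; exact: psumZ (h t t0 te). Qed.

Lemma expandsN c f : expands c f -> expands (fun k => - c k) (fun t => - f t).
Proof. by move=> [e e0 h]; exists e => // t t0 te; exact: psumN (h t t0 te). Qed.

Lemma expands_shift c f : expands c f -> expands (shiftseq c) (fun t => t * f t).
Proof. by move=> [e e0 h]; exists e => // t t0 te; exact: psum_shift (h t t0 te). Qed.

Lemma expands_unshift c f : expands c f ->
  expands (fun k => c k.+1) (fun t => (f t - c 0%N) / t).
Proof. by move=> [e e0 h]; exists e => // t t0 te; exact: psum_unshift t0 (h t t0 te). Qed.

Lemma expands_unshiftn K c f : expands c f ->
  expands (fun k => c (K + k)%N) (fun t => (f t - ps c t K) / t ^+ K).
Proof. by move=> [e e0 h]; exists e => // t t0 te; exact: psum_unshiftn t0 (h t t0 te). Qed.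

Lemma expandsM c d f g : expands c f -> expands d g ->
  expands (convseq c d) (fun t => f t * g t).
Proof.
move=> hf hg; have [A [r [r0 gc]]] := expands_geo hf.
have [B [s [s0 gd]]] := expands_geo hg.
have [gc' gd'] := geo_both (ltW r0) (ltW s0) gc gd.
have [e e0 h] := hf; have [e' e'0 h'] := hg.
have rs : 0 <= r + s by lra.
have [|e'' e''0 h''] := @small_radius (r + s) (1/8) rs; first by lra.
exists (Num.min e (Num.min e' e'')); first by rewrite !lt_min e0 e'0.
move=> t t0; rewrite !lt_min => /and3P[te te' te''].
by apply: psumM gc' gd' rs (h'' _ te'') (h _ _ _) (h' _ _ _).
Qed.

Lemma expands_neq0 c f : expands c f -> c 0%N != 0 ->
  exists2 e : R, 0 < e & forall t, t != 0 -> modulus t < e -> f t != 0.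
Proof.
move=> /(expands_bound 1)[B [e [B0 e0 H]]] c0.
have c0' : 0 < modulus (c 0%N) / 2 by rewrite divr_gt0// modulus_gt0.
have [e' e'0 H'] := small_radius B0 c0'.
exists (Num.min e e'); first by rewrite lt_min e0.
move=> t t0; rewrite lt_min => /andP[te te']; apply/eqP => ft.
have p1 : ps c t 1 = c 0%N by rewrite psS /ps big_ord0 add0r mulr1.
have := H t t0 te; rewrite ft p1 sub0r modulusN expr1.
by have := H' t te'; lra.
Qed.

Lemma expandsV c f : expands c f -> c 0%N != 0 ->
  exists2 d, expands d (fun t => (f t)^-1) &
    forall k, convseq c d k = if k == 0%N then 1 else 0.
Proof.
move=> hf c0; have [d hd] := inverse_exists c0; exists d => //.
have [A [r [r0 gc]]] := expands_geo hf.
have gd := geo_inverse (ltW r0) c0 gc hd.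
set s := r * _ in gd.
have A0 := geo_ge0 gc.
have s0 : 0 <= s.
  by rewrite mulr_ge0 ?(ltW r0)// addr_ge0// divr_ge0 ?modulus_ge0.
have [gc' gd'] := geo_both (ltW r0) s0 gc gd.
have [e e0 h] := hf; have [e' e'0 h'] := expands_neq0 hf c0.
have rs : 0 <= r + s by lra.
have [|e'' e''0 h''] := @small_radius (r + s) (1/8) rs; first by lra.
exists (Num.min e (Num.min e' e'')); first by rewrite !lt_min e0 e'0.
move=> t t0; rewrite !lt_min => /and3P[te te' te''].
by apply: psumV gc' gd' rs (h'' _ te'') hd (h _ _ _) (h' _ _ _).
Qed.

Lemma analytic_cst y z : analytic_at (fun=> y) z.
Proof. by apply/analytic_atP; exists (fun k => if k == 0%N then y else 0) => //; exact: expands_cst. Qed.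

Lemma analytic_id z : analytic_at id z.
Proof.
apply/analytic_atP; exists (fun k => (if k == 0%N then z else 0) +
  shiftseq (fun k => if k == 0%N then 1 else 0) k); first by rewrite /= addr0.
apply: eq_expands (expandsD (expands_cst z) (expands_shift (expands_cst 1))).
by exists 1 => // t _ _; rewrite mulr1.
Qed.

Lemma analyticD f g z : analytic_at f z -> analytic_at g z ->
  analytic_at (fun w => f w + g w) z.
Proof.
move=> /analytic_atP[c cz hc] /analytic_atP[d dz hd]; apply/analytic_atP.
by exists (fun k => c k + d k); [rewrite cz dz|exact: expandsD].
Qed.

Lemma analyticN f z : analytic_at f z -> analytic_at (fun w => - f w) z.
Proof.
move=> /analytic_atP[c cz hc]; apply/analytic_atP.
by exists (fun k => - c k); [rewrite cz|exact: expandsN].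
Qed.

Lemma analyticB f g z : analytic_at f z -> analytic_at g z ->
  analytic_at (fun w => f w - g w) z.
Proof. by move=> hf /analyticN; exact: analyticD. Qed.

Lemma analyticM f g z : analytic_at f z -> analytic_at g z ->
  analytic_at (fun w => f w * g w) z.
Proof.
move=> /analytic_atP[c cz hc] /analytic_atP[d dz hd]; apply/analytic_atP.
exists (convseq c d); last exact: expandsM.
by rewrite /convseq big_ord1 subn0 cz dz.
Qed.

Lemma analyticV f z : analytic_at f z -> f z != 0 ->
  analytic_at (fun w => (f w)^-1) z.
Proof.
move=> /analytic_atP[c cz hc] fz; apply/analytic_atP.
rewrite -cz in fz *; have [d hd cd] := expandsV hc fz; exists d => //.
have := cd 0%N; rewrite /convseq big_ord1 subn0/= => h.
by apply: (mulfI fz); rewrite h mulfV.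
Qed.

Lemma analyticX f n z : analytic_at f z -> analytic_at (fun w => f w ^+ n) z.
Proof.
move=> hf; elim: n => [|n IH]; first exact: analytic_cst.
rewrite (_ : (fun _ => _) = (fun w => f w * f w ^+ n)); first exact: analyticM.
by apply/funext => w; rewrite exprS.
Qed.

(** The allowed directions of approach to 0; the instances are the whole plane and the upper
    half-plane. *)
Definition cone D := forall s u, 0 < s -> D u -> D (s%:C * u).

(* Let t tend to 0 along the ray through u. *)
Lemma leading_term_Im (p j : nat) c f D : cone D -> expands c f ->
  (exists2 e : R, 0 < e & forall t, D t -> t != 0 -> modulus t < e ->
     0 <= Im (f t / t ^+ p)) ->
  (forall i, (i < j)%N -> c i = 0) ->
  forall u, D u -> u != 0 -> 0 <= Im (c j * u ^+ j / u ^+ p).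
Proof.
move=> coneD /(expands_bound j.+1)[B [e [B0 e0 H]]] [e' e'0 H'] cj u Du u0.
rewrite leNgt; apply/negP => neg.
set v := c j * u ^+ j / u ^+ p in neg.
pose Q := B * modulus u ^+ j.+1 / modulus u ^+ p.
have Q0 : 0 <= Q by rewrite divr_ge0 ?mulr_ge0 ?exprn_ge0 ?modulus_ge0.
have mu : 0 < modulus u by rewrite modulus_gt0.
(* After rescaling by s^p / s^j the remainder is at most s Q, so s (Q + 1) < - Im v keeps the
   imaginary part negative. The other bounds bring t = s u into both discs. *)
pose m := Num.min (- Im v / (Q + 1)) (Num.min e e' / modulus u).
have m0 : 0 < m.
  by rewrite lt_min !divr_gt0 ?lt_min ?e0//; lra.
pose s := m / 2; have s0 : 0 < s by rewrite divr_gt0.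
have sm : s < m by rewrite /s; lra.
pose t := s%:C * u.
have sC : s%:C != 0 :> R[i] by rewrite -modulus_gt0 modulus_real gtr0_norm.
have t0 : t != 0 by rewrite mulf_neq0.
have mt : modulus t = s * modulus u by rewrite modulusM modulus_real gtr0_norm.
move: sm; rewrite lt_min !ltr_pdivlMr//; last by lra.
rewrite -mt lt_min => /andP[sQ /andP[te te']].
have := H' t (coneD _ _ s0 Du) t0 te'.
have := H t t0 te.
have -> : ps c t j.+1 = c j * t ^+ j.
  by rewrite psS /ps big1 ?add0r// => i _; rewrite cj ?mul0r.
move=> h1 h2.
have : 0 <= Im ((s ^+ p / s ^+ j)%:C * (f t / t ^+ p)).
  by rewrite Im_scale mulr_ge0// divr_ge0// exprn_ge0// ltW.
have -> : (s ^+ p / s ^+ j)%:C * (f t / t ^+ p) =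
   v + (s%:C ^+ j)^-1 * ((f t - c j * t ^+ j) / u ^+ p).
  rewrite rmorphM /= rmorphXn fmorphV rmorphXn /v /t !exprMn.
  by field; rewrite !expf_neq0.
rewrite Im_add.
set E := _ * (_ / _).
have : modulus E <= s * Q.
  rewrite /E modulusM modulusV modulusX modulus_real gtr0_norm// modulusM modulusV modulusX.
  rewrite mulrA ler_pdivrMr ?exprn_gt0// ler_pdivrMl ?exprn_gt0//.
  apply: (le_trans h1); rewrite mt /Q exprMn le_eqVlt; apply/orP; left; apply/eqP.
  by rewrite exprS; field; rewrite gt_eqF// exprn_gt0.
have := Im_le_modulus E; have := ler_norm (Im E).
by move: sQ; rewrite mulrDr mulr1; lra.
Qed.

Lemma cone_all : cone (fun=> True).
Proof. by []. Qed.

Lemma expands_inj c c' f f' D : cone D -> (exists2 u, D u & u != 0) ->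
  expands c f -> expands c' f' ->
  (exists2 e : R, 0 < e & forall t, D t -> t != 0 -> modulus t < e -> f t = f' t) ->
  c =1 c'.
Proof.
move=> coneD [u Du u0] hc hc' [e e0 H].
have hd := expandsD hc (expandsN hc').
elim/ltn_ind => j IH.
apply/eqP; rewrite -subr_eq0; set y := _ - _.
(* Multiplied by l, the leading term along u becomes -i |y u^j|^2, whose imaginary part is
   nonnegative only if y u^j = 0. *)
pose l := - 'i * (y * u ^+ j)^*.
have := @leading_term_Im 0 j _ _ D coneD (expandsZ l hd) _ _ u Du u0.
rewrite -/y expr0 divr1 -mulrA /l => h.
have : 0 <= Im (- 'i * (y * u ^+ j)^* * (y * u ^+ j)).
  apply: h => [|i ij]; last by rewrite IH// subrr mulr0.
  by exists e => // t Dt t0 te; rewrite H// subrr mulr0 mul0r.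
have : y * u ^+ j == 0 -> y == 0 by rewrite mulf_eq0 (negPf (expf_neq0 _ u0)) orbF.
case: (y * u ^+ j) => a b h0 h1; apply: h0; rewrite eq_complex /=.
have h2 : a ^+ 2 + b ^+ 2 <= 0 by move: h1; simpc => /=; nra.
by move: h2; rewrite -[_ == _]sqrf_eq0 -[b == _]sqrf_eq0; have := sqr_ge0 a; have := sqr_ge0 b => ? ? ?;
   apply/andP; split; apply/eqP; lra.
Qed.

Lemma expands_isolated c f : expands c f -> (exists2 k, (0 < k)%N & c k != 0) ->
  exists2 e : R, 0 < e & forall t, t != 0 -> modulus t < e -> f t != c 0%N.
Proof.
move=> hf [k0 k00 ck0].
have ex : exists k, (0 < k)%N && (c k != 0) by exists k0; rewrite k00.
case: (ex_minnP ex) => -[//|k] /andP[_ ck] kmin.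
have cj i : (0 < i)%N -> (i < k.+1)%N -> c i = 0.
  move=> i0 ik; apply/eqP/negPn/negP => ci.
  by have := kmin i; rewrite i0 ci leqNgt ik => /(_ isT).
have [|e e0 H] := expands_neq0 (expands_unshiftn k.+1 hf); first by rewrite addn0.
exists e => // t t0 te; apply: contraNneq (H t t0 te) => ->.
rewrite /ps big_ord_recl expr0 mulr1 big1 ?addr0 ?subrr ?mul0r// => i _.
by rewrite cj ?mul0r// lift0 ltnS.
Qed.

Lemma expands_locally_cst c f : expands c f -> (forall k, (0 < k)%N -> c k = 0) ->
  exists2 e : R, 0 < e & forall t, t != 0 -> modulus t < e -> f t = c 0%N.
Proof.
move=> [e e0 H] ck; exists e => // t t0 te.
apply: psum_unique (H t t0 te) _.
have -> : c = (fun k => if k == 0%N then c 0%N else 0).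
  by apply/funext => -[//|k]; rewrite ck.
exact: psum_cst.
Qed.

Lemma power_Im_neg (c : R[i]) k : c != 0 -> (0 < k)%N -> exists2 u : R[i], u != 0 & Im (c * u ^+ k) < 0.
Proof.
move=> c0 k0; pose y := - 'i / c; exists (k.-root y).
  by rewrite rootC_eq0// mulf_neq0 ?invr_eq0// oppr_eq0 eq_complex /= oner_eq0 andbF.
by rewrite rootCK// /y mulrC divfK//= ltrN10.
Qed.

(* For k > 1 every number has a k-th root in the closed upper half-plane; two
   right-hand sides are tried, since the root may be real. *)
Lemma power_Im_neg_upper (c : R[i]) k : c != 0 -> (1 < k)%N ->
  exists2 u : R[i], 0 < Im u & Im (c * u ^+ k) < 0.
Proof.
move=> c0 k1; have k0 : (0 < k)%N by exact: ltnW.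
have main (y : R[i]) : Im (c * y) < 0 -> Im y != 0 ->
    exists2 u : R[i], 0 < Im u & Im (c * u ^+ k) < 0.
  move=> cy y0; exists (k.-root y); last by rewrite rootCK.
  have := Im_rootC_ge0 y k1; rewrite -complexIm ler0c le_eqVlt => /orP[/eqP h|//].
  case/negP: y0; rewrite -(rootCK k0 y) (@real_of_Im0 _ (k.-root y))//.
  by rewrite -rmorphXn.
have [h|h] := eqVneq (Im (- 'i / c)) 0; last first.
  by apply: main h; rewrite mulrC divfK//= ltrN10.
(* Here -i/c is real, so 1/c has real part 0; if (1 - i)/c were real as well, 1/c would vanish. *)
apply: (main ((1 - 'i) / c)); first by rewrite mulrC divfK//= sub0r ltrN10.
rewrite mulrBl Im_add mul1r -mulNr h addr0; apply/eqP => h'.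
have : (- 'i / c) * c != 0 by rewrite divfK// oppr_eq0 eq_complex /= oner_eq0 andbF.
move: h; rewrite Im_mul /= oppr0 mul0r add0r mulN1r => /eqP; rewrite oppr_eq0 => /eqP h.
have : c^-1 == 0 by rewrite eq_complex h h' eqxx.
by rewrite invr_eq0 (negPf c0).
Qed.

(** For c = a + ib and u = s + i the hypothesis reads a + b s >= 0 for all real s, whence b = 0. *)
Lemma upper_linear_ge0 (c : R[i]) : (forall u : R[i], 0 < Im u -> 0 <= Im (c * u)) -> 0 <= c.
Proof.
case: c => a b H.
have hab s : 0 <= a + b * s by have := H (s +i* 1); rewrite /= mulr1; apply.
have b0 : b = 0.
  apply/eqP/negPn/negP => b0; have := hab (- (a + 1) / b).
  by rewrite mulrC divfK//; lra.
by rewrite lecE /= b0 eqxx; have := hab 0; rewrite mulr0 addr0.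
Qed.

End PuncturedExpansion.

(** * Identity theorem and minimum principle in the upper half-plane *)

Section HalfPlane.
Variable R : realType.
Implicit Types (z w t u y : R[i]) (c d : nat -> R[i]) (A B r e s x : R).
Implicit Types (f g : R[i] -> R[i]).
Local Open Scope classical_set_scope.

Lemma upper_near z : 0 < Im z -> forall w, modulus (w - z) < Im z -> 0 < Im w.
Proof.
move=> z0 w wz; have := Im_le_modulus (w - z); rewrite Im_add Im_opp ler_norml.
by move=> /andP[]; lra.
Qed.

Lemma upperP z : upper_half_plane z = (0 < Im z).
Proof. by []. Qed.

Definition analytic_upper f := forall z, 0 < Im z -> analytic_at f z.

Lemma analytic_continuous f z e : analytic_at f z -> 0 < e ->
  exists2 r, 0 < r & forall w, modulus (w - z) < r -> modulus (f w - f z) < e.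
Proof.
move=> /analytic_atP[c cz /(expands_bound 1)[B [r [B0 r0 H]]]] e0.
have e2 : 0 < e / 2 by lra.
have [r' r'0 H'] := small_radius B0 e2.
exists (Num.min r r'); first by rewrite lt_min r0.
move=> w; rewrite lt_min => /andP[wr wr'].
have [->|wz] := eqVneq w z; first by rewrite subrr modulus0.
have := H (w - z); rewrite subr_eq0 (addrC z) subrK => /(_ wz wr).
rewrite psS /ps big_ord0 add0r !expr0 mulr1 cz expr1.
by have := H' _ wr'; lra.
Qed.

Lemma analytic_value_dichotomy f z y : analytic_at f z ->
  (exists2 e : R, 0 < e & forall w, modulus (w - z) < e -> f w = y) \/
  (exists2 e : R, 0 < e & forall w, w != z -> modulus (w - z) < e -> f w != y).
Proof.
move=> /analytic_atP[c cz hc].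
have hc' := expandsD hc (expands_cst (- y)).
have [cy|cy] := eqVneq (c 0%N) y; last first.
  right; have [|e e0 H] := expands_neq0 hc'.
    by rewrite /= subr_eq0.
  exists e => // w wz we; have := H (w - z); rewrite subr_eq0 (addrC z) subrK.
  by rewrite subr_eq0; apply.
have [[k kP]|hn] := pselect (exists k, (0 < k)%N && (c k != 0)).
  right; have [|e e0 H] := expands_isolated hc.
    by have /andP[] := kP; exists k.
  exists e => // w wz we; have := H (w - z); rewrite subr_eq0 (addrC z) subrK.
  by rewrite cy; apply.
left; have [|e e0 H] := expands_locally_cst hc.
  move=> k k0; apply/eqP/negPn/negP => ck; apply: hn; exists k.
  by rewrite k0.
exists e => // w we.
have [->|wz] := eqVneq w z; first by rewrite -cz.
by have := H (w - z); rewrite subr_eq0 (addrC z) subrK cy; apply.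
Qed.

(** Connectedness of the segment from [z0] to any other point: the parameters near whose point f = y
    holds form an open set. It is also closed, because by the local dichotomy a limit of such points
    cannot be a point around which the value y is avoided. *)
Lemma identity_upper f y z0 : analytic_upper f -> 0 < Im z0 ->
  (\forall w \near z0, f w = y) -> forall z, 0 < Im z -> f z = y.
Proof.
move=> hf z00 near0 z1 z10.
pose p (s : R) : R[i] := z0 + s%:C * (z1 - z0).
have pE s s' : p s' - p s = (s' - s)%:C * (z1 - z0).
  by rewrite /p rmorphB; ring.
pose O := [set s : R | \forall w \near p s, f w = y].
have pU s : `[0, 1]%classic s -> 0 < Im (p s).
  rewrite /= in_itv /= => /andP[s0 s1].
  rewrite /p Im_add Im_scale Im_add Im_opp; nra.
have pnear s e : 0 < e -> exists2 r, 0 < r & forall s', `|s - s'| < r ->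
    modulus (p s' - p s) < e.
  move=> e0; exists (e / (modulus (z1 - z0) + 1)).
    by rewrite divr_gt0// ltr_wpDl ?modulus_ge0.
  move=> s'; rewrite pE modulusM modulus_real distrC.
  rewrite ltr_pdivlMr ?ltr_wpDl ?modulus_ge0// mulrDr mulr1.
  by have := normr_ge0 (s' - s); lra.
have cO : connected `[(0 : R), 1] := @segment_connected _ _ _.
have : `[(0:R), 1] `&` O = `[(0 : R), 1].
  apply: cO.
  - exists 0; split; first by rewrite /= in_itv /= lexx ler01.
    by rewrite /O /= /p mul0r addr0.
  - exists O => //; rewrite openE => s /near_modulusP[e e0 H].
    have [r r0 H'] : exists2 r, 0 < r & forall s', `|s - s'| < r ->
      modulus (p s' - p s) < e / 2 by apply: pnear; lra.
    apply: (iffRL (nbhs_ballP s O)); exists r => [|s' rs]; first exact: r0.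
    have h := H' s' rs.
    apply/near_modulusP; exists (e / 2); first by lra.
    move=> w wp; apply: H; have := modulusD (w - p s') (p s' - p s).
    by rewrite addrA subrK; lra.
  - exists (closure O); first exact: closed_closure.
    rewrite eqEsubset; split=> s [s01 Os].
      by split; [exact: s01|exact: subset_closure].
    split; first exact: s01.
    have [[e e0 H]|[e e0 H]] := analytic_value_dichotomy y (hf _ (pU _ s01)).
      by apply/near_modulusP; exists e.
    have [r r0 H'] := pnear s e e0.
    have [|s' [Os' ss']] := Os (ball s r); first exact: nbhsx_ballx.
    have := H (p s'); have /near_modulusP[e' e'0 H''] := Os'.
    (* The punctured neighbourhood says nothing when both parameters give the same point, but then
       the claim is [Os'] itself. *)
    have [pp|_] := eqVneq (p s') (p s); first move=> _.
      by apply/near_modulusP; exists e' => [//|w]; rewrite -pp; exact: H''.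
    move=> /(_ isT (H' s' ss')) /eqP ne; exfalso; apply: ne; apply: H''.
    by rewrite subrr modulus0.
have p1 : p 1 = z1 by rewrite /p mul1r addrC subrK.
move=> h; have : (`[(0 : R), 1] `&` O) 1.
  by rewrite h /= in_itv /= lexx ler01.
move=> [_]; rewrite /O /= p1 => /near_modulusP[e e0]; apply.
by rewrite subrr modulus0.
Qed.

(** Otherwise let c_k be the first nonzero coefficient with k > 0: some direction u makes Im (c_k
    u^k) negative, and Im f drops below its value at z along u. *)
Lemma local_Im_min f z : analytic_at f z ->
  (exists2 e : R, 0 < e & forall w, modulus (w - z) < e -> Im (f z) <= Im (f w)) ->
  \forall w \near z, f w = f z.
Proof.
move=> hf [e e0 H].
have [c cz hc] := (analytic_atP _ _).1 hf.
have [[k0 kP]|hn] := pselect (exists k, (0 < k)%N && (c k != 0)); last first.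
  have [|e' e'0 H'] := expands_locally_cst hc.
    move=> k k0; apply/eqP/negPn/negP => ck; apply: hn; exists k.
    by rewrite k0.
  apply/near_modulusP; exists e' => // w we.
  have [->//|wz] := eqVneq w z.
  by have := H' (w - z); rewrite subr_eq0 (addrC z) subrK cz; apply.
have ex : exists k, (0 < k)%N && (c k != 0) by exists k0.
case: (ex_minnP ex) => k /andP[k_gt0 ck] kmin.
have [u u0 uneg] := power_Im_neg ck k_gt0.
have hc' := expandsD hc (expands_cst (- f z)).
suff : 0 <= Im (c k * u ^+ k) by rewrite leNgt uneg.
have := @leading_term_Im R 0 k _ _ (fun=> True) (@cone_all R) hc' _ _ u I u0.
rewrite expr0 divr1 -[k == 0%N]negbK -lt0n k_gt0 addr0; apply.
  exists e => // t _ t0 te; rewrite expr0 divr1 Im_add Im_opp subr_ge0.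
  by apply: H; rewrite (addrC z) addrK.
move=> i ik; have [->|i0] := eqVneq i 0%N; first by rewrite cz subrr.
rewrite addr0; apply/eqP/negPn/negP => ci.
by have := kmin i; rewrite lt0n i0 ci leqNgt ik => /(_ isT).
Qed.

(** The hypothesis says that the lower limits of Im g at infinity and at the real axis are
    nonnegative, in the form that Im g < -e only occurs in a compact rectangle of the open
    half-plane. A negative value then yields a global minimum, so g is constant, although its value
    there is excluded outside the rectangle. *)
Lemma Im_min_principle g : analytic_upper g ->
  (forall e, 0 < e -> exists B (d : R), 0 < d /\ forall z, 0 < Im z -> Im (g z) < - e ->
     [/\ `|Re z| <= B, Im z <= B & d <= Im z]) ->
  forall z, 0 < Im z -> 0 <= Im (g z).
Proof.
move=> hg hlim z0 z00; rewrite leNgt; apply/negP => neg.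
have [|B [d [d0 Hd]]] := hlim (- Im (g z0) / 2); first by lra.
pose K := `[- B, B] `*` `[d, B] : set (R * R).
have cK : compact K by apply: compact_setX; exact: segment_compact.
have z0K : K (Re z0, Im z0).
  have [|h1 h2 h3] := Hd z0 z00; first by lra.
  by split => /=; rewrite in_itv /= -?ler_norml ?h1 ?h2 ?h3.
pose h (p : R * R) := Im (g (p.1 +i* p.2)).
have ch : {within K, continuous h}.
  apply: continuous_in_subspaceT => -[a b] /set_mem[/= _].
  rewrite in_itv /= => /andP[db _].
  apply/cvgrPdist_lt => e e0.
  have [|r r0 H] := @analytic_continuous g (a +i* b) e _ e0.
    by apply: hg => /=; exact: lt_le_trans db.
  exists (ball a (r / 2), ball b (r / 2)).
    by split; apply: nbhsx_ballx; lra.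
  move=> -[a' b'] [/= ha hb].
  rewrite -normrN opprB -Im_opp -Im_add; apply: le_lt_trans (Im_le_modulus _) _.
  apply: H; apply: le_lt_trans (modulus_le_ReIm _) _ => /=.
  by move: ha hb; rewrite /ball/= !(distrC _ a') !(distrC _ b'); lra.
have [|[a b] /set_mem abK hmin] := compact_EVT_min _ cK ch; first by exists (Re z0, Im z0).
have b0 : 0 < b by have [_ /=] := abK; rewrite in_itv /= => /andP[]; lra.
pose z1 := a +i* b.
have gz1 : Im (g z1) <= Im (g z0).
  have := hmin (Re z0, Im z0); rewrite /h /= inE => /(_ z0K).
  by case: z0 {z00 neg Hd z0K hmin}.
have glob w : 0 < Im w -> Im (g z1) <= Im (g w).
  move=> w0; have [gw|] := ltP (Im (g w)) (- (- Im (g z0) / 2)); last by lra.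
  have [h1 h2 h3] := Hd w w0 gw.
  have := hmin (Re w, Im w); rewrite /h /= inE.
  rewrite (_ : Re w +i* Im w = w); last by case: (w).
  by apply; split => /=; rewrite in_itv /= -?ler_norml ?h1 ?h2 ?h3.
have loc : \forall w \near z1, g w = g z1.
  apply: local_Im_min; first exact: hg.
  exists b => // w wz; apply: glob; exact: (@upper_near z1).
have cst := identity_upper hg (b0 : 0 < Im z1) loc.
have B0 : 0 <= B.
  by have [_ /=] := abK; rewrite in_itv /= => /andP[]; lra.
(* A point above the rectangle, where the constant g still takes the negative value. *)
have := Hd (0 +i* (B + 1)) => /=; rewrite cst/=; last by lra.
by move=> /(_ _ _)[]; lra.
Qed.

(** As Im (1/(z - x)) = - Im z / |z - x|^2, a value Im g < -e forces e |z - x|^2 < A Im z. Hence |z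
    - x| < A/e, which bounds z, and together with |z - x| >= r this keeps Im z away from 0. *)
Lemma Im_min_principle_pole g x A : analytic_upper g -> 0 <= A ->
  (forall z, 0 < Im z -> A * Im (z - x%:C)^-1 <= Im (g z)) ->
  (forall e, 0 < e -> exists2 r, 0 < r & forall z, 0 < Im z ->
     modulus (z - x%:C) < r -> - e <= Im (g z)) ->
  forall z, 0 < Im z -> 0 <= Im (g z).
Proof.
move=> hg A0 hA hx; apply: Im_min_principle => // e e0.
have [r r0 Hr] := hx e e0.
(* A + 1 instead of A in the denominator covers A = 0. *)
exists (`|x| + A / e), (e * r ^+ 2 / (A + 1)); split.
  by rewrite divr_gt0 ?mulr_gt0 ?exprn_gt0//; lra.
move=> z z0 gz.
have tr : r <= modulus (z - x%:C).
  by rewrite leNgt; apply/negP => /(Hr z z0); lra.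
have := hA z z0; rewrite Im_inv mulNr.
have Imt : Im (z - x%:C) = Im z by rewrite Im_add Im_opp /= oppr0 addr0.
have Ret : Re (z - x%:C) = Re z - x by rewrite Re_add Re_opp.
have h1 := Im_le_modulus (z - x%:C); have h2 := Re_le_modulus (z - x%:C).
rewrite Imt in h1 *; rewrite Ret in h2.
set m := modulus _ in tr h1 h2 *; move=> h3.
have m0 : 0 < m by exact: lt_le_trans tr.
have h4 : e * m ^+ 2 < A * Im z.
  rewrite -ltr_pdivlMr ?exprn_gt0// -mulrA; lra.
have h5 : m < A / e.
  rewrite ltr_pdivlMr// -(ltr_pM2l m0).
  have : A * Im z <= A * m by rewrite ler_wpM2l// (le_trans (ler_norm _) h1).
  by rewrite (_ : m * (m * e) = e * m ^+ 2); [lra|ring].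
split.
- have := ler_normD (Re z - x) x; rewrite subrK; lra.
- by have := normr_ge0 x; have := ler_norm (Im z); lra.
- rewrite ler_pdivrMr; last by lra.
  have : r ^+ 2 <= m ^+ 2 by rewrite lerXn2r ?nnegrE// ltW.
  move=> /(ler_wpM2l (ltW e0)); nra.
Qed.

End HalfPlane.

(** * Taylor expansions of Pick functions at a boundary point *)

Section BoundaryTaylor.
Variable R : realType.
Implicit Types (z w t u y : R[i]) (a b c d : nat -> R[i]) (A B r e s x : R).
Implicit Types (f g F G : R[i] -> R[i]).
Local Open Scope classical_set_scope.

(** This is [laurent_expansion] without principal part; the extension F may take any value at x
    itself. *)
Definition taylor x f c := exists F : R[i] -> R[i],
  [/\ (forall z, 0 < Im z -> F z = f z),
      (\forall z \near x%:C^', analytic_at F z)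
    & expands c (fun t => F (x%:C + t))].

Lemma cone_upper : cone (fun u : R[i] => 0 < Im u).
Proof. by move=> s u s0 u0; rewrite Im_scale mulr_gt0. Qed.

Lemma upper_neq0 z : 0 < Im z -> z != 0.
Proof. by apply: contraTneq => ->; rewrite ltxx. Qed.

Lemma Im_real_shift x t : Im (x%:C + t) = Im t.
Proof. by rewrite Im_add add0r. Qed.

Lemma taylor_inj x f f' c c' : taylor x f c -> taylor x f' c' ->
  (forall z, 0 < Im z -> f z = f' z) -> c =1 c'.
Proof.
move=> [F [Ff _ hc]] [F' [Ff' _ hc']] ff'.
apply: expands_inj cone_upper _ hc hc' _.
  by exists 'i => /=; [exact: ltr01|apply: upper_neq0 => /=; exact: ltr01].
by exists 1 => // t t0 _ _; rewrite Ff ?Ff' ?ff'// Im_real_shift.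
Qed.

Lemma taylor_leading_Im x f c j : pick_class f -> taylor x f c -> Im (c 0%N) = 0 ->
  (0 < j)%N -> (forall i, (0 < i)%N -> (i < j)%N -> c i = 0) ->
  forall u, 0 < Im u -> 0 <= Im (c j * u ^+ j).
Proof.
move=> hf [F [Ff _ hc]] c0 j0 cj u u0.
have hc' := expandsD hc (expands_cst (- c 0%N)).
have := leading_term_Im (p := 0) (j := j) cone_upper hc' _ _ u0 (upper_neq0 u0).
rewrite expr0 divr1 -[j == 0%N]negbK -lt0n j0 addr0; apply.
  exists 1 => // t t0 _ _; rewrite expr0 divr1 Im_add Im_opp c0 oppr0 addr0.
  have xt : 0 < Im (x%:C + t) by rewrite Im_real_shift.
  by rewrite Ff//; exact: (hf _ xt).2.
move=> i ij; have [->|i0] := eqVneq i 0%N; first by rewrite subrr.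
by rewrite addr0 cj// lt0n.
Qed.

Lemma taylor_Im0_ge0 x f c : pick_class f -> taylor x f c -> 0 <= Im (c 0%N).
Proof.
move=> hf [F [Ff _ hc]].
have i0 : 0 < Im ('i : R[i]) by exact: ltr01.
have := leading_term_Im (p := 0) (j := 0) cone_upper hc _ _ i0 (upper_neq0 i0).
rewrite !expr0 divr1 mulr1; apply=> //.
exists 1 => // t t0 _ _; rewrite expr0 divr1.
have xt : 0 < Im (x%:C + t) by rewrite Im_real_shift.
by rewrite Ff//; exact: (hf _ xt).2.
Qed.

Lemma pick_analytic f : pick_class f -> analytic_upper f.
Proof. by move=> hf z z0; exact: (hf z z0).1. Qed.

Lemma taylor_cst x f c : pick_class f -> taylor x f c ->
  (forall k, (0 < k)%N -> c k = 0) -> forall z, 0 < Im z -> f z = c 0%N.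
Proof.
move=> hf [F [Ff _ hc]] ck.
have [e e0 H] := expands_locally_cst hc ck.
(* The disc of radius e/2 about this point lies in the half-plane and in the disc of radius e about
   x, where F is constant. *)
have z0 : 0 < Im (x +i* (e / 2)) by rewrite /=; lra.
apply: (identity_upper (pick_analytic hf) z0).
apply/near_modulusP; exists (e / 2); first by lra.
move=> w wz; have w0 : 0 < Im w by exact: (upper_near z0).
rewrite -Ff//; have := H (w - x%:C); rewrite (addrC x%:C) subrK; apply.
  by apply: upper_neq0; rewrite Im_add Im_opp /= subr0.
have := modulusD (w - (x +i* (e / 2))) (0 +i* (e / 2)).
have -> : w - (x +i* (e / 2)) + 0 +i* (e / 2) = w - x%:C.
  by apply: eq_ReIm; rewrite !(Re_add, Re_opp, Im_add, Im_opp) /=; ring.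
have -> : modulus (0 +i* (e / 2)) = e / 2.
  by rewrite /= expr0n add0r sqrtr_sqr ger0_norm//; lra.
lra.
Qed.

(** The leading nonconstant term c_k u^k must have nonnegative imaginary part on the half-plane. For
    k > 1 the powers u^k reach too many directions; for k = 1 this forces c_1 to be real and
    positive. *)
Lemma taylor_coef1 x f c : pick_class f -> taylor x f c -> Im (c 0%N) = 0 ->
  (forall k, (0 < k)%N -> c k = 0) \/ 0 < c 1%N.
Proof.
move=> hf hc c0.
have [[k0 kP]|hn] := pselect (exists k, (0 < k)%N && (c k != 0)); last first.
  left=> k k0; apply/eqP/negPn/negP => ck; apply: hn; exists k.
  by rewrite k0.
right; have ex : exists k, (0 < k)%N && (c k != 0) by exists k0.
case: (ex_minnP ex) => k /andP[k_gt0 ck] kmin.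
have lead := taylor_leading_Im hf hc c0 k_gt0 _.
have {}lead : forall u, 0 < Im u -> 0 <= Im (c k * u ^+ k).
  apply: lead => i i0 ik; apply/eqP/negPn/negP => ci.
  by have := kmin i; rewrite i0 ci leqNgt ik => /(_ isT).
have [k1|k1] := leqP k 1; last first.
  have [u u0] := power_Im_neg_upper ck k1.
  by rewrite ltNge lead.
have {}k1 : k = 1%N by apply/eqP; rewrite eqn_leq k1.
rewrite k1 in ck lead.
rewrite lt_neqAle eq_sym ck upper_linear_ge0//.
Qed.

(** A zero of Im f would be an interior minimum and make f constant, against c_1 != 0. *)
Lemma pick_Im_gt0 x f c : pick_class f -> taylor x f c -> c 1%N != 0 ->
  forall z, 0 < Im z -> 0 < Im (f z).
Proof.
move=> hf hc c1 z z0; have [az fz] := hf z z0.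
rewrite lt_neqAle fz andbT; apply/negP => /eqP fz0.
have loc : \forall w \near z, f w = f z.
  apply: local_Im_min az _; exists (Im z) => // w /(upper_near z0) w0.
  by rewrite -fz0; exact: (hf w w0).2.
have cst := identity_upper (pick_analytic hf) z0 loc.
have hy : taylor x (fun=> f z) (fun k => if k == 0%N then f z else 0).
  exists (fun=> f z); split=> //; last exact: expands_cst.
  by apply/dnear_modulusP; exists 1 => [|w _ _]; [exact: ltr01|exact: (analytic_cst (f z) w)].
by have := taylor_inj hc hy cst 1%N => /= h; rewrite h eqxx in c1.
Qed.

(* Along t = s + i s^3 the imaginary part of c_1 t is O(s^3), while that of
   c_2 t^2 is s^2 Im c_2 + O(s^3). *)
Lemma taylor_Im2_ge0 x f c : pick_class f -> taylor x f c -> Im (c 0%N) = 0 ->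
  Im (c 1%N) = 0 -> 0 <= Im (c 2%N).
Proof.
move=> hf [F [Ff _ hc]] c0 c1.
have [B [e [B0 e0 H]]] := expands_bound 3 hc.
rewrite leNgt; apply/negP => neg.
(* The three errors of order s^3: Re c_1 from c_1 t, 3 |c_2| from replacing t^2 by s^2, and 8 B from
   the remainder, as |t| <= 2s. *)
pose M := `|Re (c 1%N)| + 3 * modulus (c 2%N) + 8 * B.
have M0 : 0 <= M by rewrite !addr_ge0 ?mulr_ge0 ?modulus_ge0.
pose m := Num.min 1 (Num.min (e / 2) (- Im (c 2%N) / (M + 1))).
have m0 : 0 < m by rewrite !lt_min ltr01 !divr_gt0//; lra.
pose s : R := m / 2; have s0 : 0 < s by rewrite /s; lra.
have : s < m by rewrite /s; lra.
rewrite !lt_min => /and3P[s1 se]; rewrite ltr_pdivlMr; last by lra.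
move=> sM.
pose t : R[i] := s +i* (s ^+ 3).
have t0 : 0 < Im t by rewrite /= exprn_gt0.
have s31 : s ^+ 3 <= s by rewrite !exprS expr0 mulr1; nra.
have mt : modulus t <= 2 * s.
  apply: (le_trans (modulus_le_ReIm _)) => /=.
  have s30 : 0 <= s ^+ 3 by rewrite exprn_ge0 ?ltW.
  rewrite (gtr0_norm s0) (ger0_norm s30); lra.
have := H t (upper_neq0 t0) _.
have xt : 0 < Im (x%:C + t) by rewrite Im_real_shift.
rewrite Ff// => /(_ (le_lt_trans mt _)) h.
have {}h : modulus (f (x%:C + t) - ps c t 3) <= B * modulus t ^+ 3 by apply: h; lra.
have fx := (hf _ xt).2.
have := le_trans (Im_le_modulus _) h; rewrite Im_add Im_opp ler_norml => /andP[_].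
have mt3 : modulus t ^+ 3 <= 8 * s ^+ 3.
  have -> : 8 * s ^+ 3 = (2 * s) ^+ 3 by ring.
  by rewrite lerXn2r ?nnegrE ?modulus_ge0//; lra.
have -> : ps c t 3 = c 0%N + c 1%N * t + c 2%N * t ^+ 2.
  by rewrite !psS /ps big_ord0 add0r expr0 expr1 mulr1.
have -> : c 2%N * t ^+ 2 = (s ^+ 2)%:C * c 2%N + c 2%N * (t ^+ 2 - (s ^+ 2)%:C) by ring.
rewrite !Im_add c0 Im_mul c1 mul0r addr0 add0r Im_scale.
set E := c 2%N * _.
have hE : modulus E <= 3 * modulus (c 2%N) * s ^+ 3.
  rewrite /E modulusM rmorphXn subr_sqr modulusM.
  have h1 : modulus (t - s%:C) <= s ^+ 3.
    apply: (le_trans (modulus_le_ReIm _)); rewrite Re_add Re_opp Im_add Im_opp /=.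
    by rewrite subrr normr0 add0r subr0 ger0_norm// exprn_ge0// ltW.
  have h2 : modulus (t + s%:C) <= 3 * 1.
    apply: (le_trans (modulusD _ _)); rewrite modulus_real ger0_norm; lra.
  have := ler_pM (modulus_ge0 _) (modulus_ge0 _) h1 h2.
  move=> /(ler_wpM2l (modulus_ge0 (c 2%N))); lra.
have := Im_le_modulus E; have := ler_norm (Im E).
have := ler_norm (Re (c 1%N)).
have s3 : 0 <= s ^+ 3 by rewrite exprn_ge0 ?ltW.
have s2 : 0 < s ^+ 2 by rewrite exprn_gt0.
move=> h1 h2 h3.
have h4 := ler_wpM2r s3 h1.
have h5 := ler_wpM2l B0 mt3.
have : s ^+ 2 * (s * (M + 1)) < s ^+ 2 * - Im (c 2%N) by rewrite ltr_pM2l.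
have it : Im t = s ^+ 3 by [].
move: fx h3 h4 h5 hE; rewrite it /M.
move: (Im (f _)) (modulus E) (Im E) (modulus t ^+ 3) h2 => I0 mE IE mt'.
lra.
Qed.

End BoundaryTaylor.

(** * Julia's reduction and its inverse *)

Section SchurStep.
Variable R : realType.
Implicit Types (z w t u y : R[i]) (a b c d : nat -> R[i]) (A B r e s x : R).
Implicit Types (f g F G : R[i] -> R[i]).
Local Open Scope classical_set_scope.

(* The relation between the Taylor coefficients a of f and b of g when
   f - a_0 = 1/(1/(a_1 t) - g). *)
Definition schur_rel a b :=
  forall k, a k.+2 = a 1%N * convseq (fun i => a i.+1) b k.

(** If d expands t/(f - a_0), then g = 1/(a_1 t) - 1/(f - a_0) = (d_0 - t/(f - a_0))/t, whose
    coefficients are -d_(k+1). *)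
Lemma schur_rel_inverse a d : a 1%N != 0 ->
  (forall k, convseq (fun i => a i.+1) d k = if k == 0%N then 1 else 0) ->
  schur_rel a (fun k => - d k.+1).
Proof.
move=> a1 hd k.
have d0 : a 1%N * d 0%N = 1 by have := hd 0%N; rewrite /convseq big_ord1.
have := hd k.+1; rewrite {1}/convseq big_ord_recr /= subnn => /eqP.
rewrite addr_eq0 => /eqP h; apply: (mulIf (x := d 0%N)).
  by apply: contraNneq (oner_neq0 R[i]) => d00; rewrite -d0 d00 mulr0.
rewrite mulrAC d0 mul1r -[LHS]opprK -h -sumrN; apply: eq_bigr => i _.
by rewrite mulrN subSn// -ltnS.
Qed.

Lemma schur_exists a : a 1%N != 0 -> exists b, schur_rel a b.
Proof.
move=> a1; have [d hd] := @inverse_exists R (fun i => a i.+1) a1.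
by exists (fun k => - d k.+1); exact: schur_rel_inverse.
Qed.

(** The system is triangular: b_k enters the equation for a_(k+2) with the factor a_1^2, next to b_i
    with i < k only. *)
Lemma schur_prefix_reduce a b a' b' N : schur_rel a b -> schur_rel a' b' ->
  a 1%N != 0 -> (forall k, (k < N.+2)%N -> a' k = a k) ->
  forall k, (k < N)%N -> b' k = b k.
Proof.
move=> hab hab' a1 haa; elim/ltn_ind => k IH kN.
have := hab' k; have := hab k; rewrite !haa// => ->.
rewrite /convseq !big_ord_recl subn0 /= !haa// => /(mulfI a1).
rewrite [X in _ + X = _](eq_bigr (fun i : 'I_k => a' (lift ord0 i).+1 * b' (k - lift ord0 i)%N)).
  by move=> /addIr /(mulfI a1) ->.
move=> i _; have ik := ltn_ord i; rewrite lift0 /= haa; last by lia.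
by rewrite IH//; lia.
Qed.

Lemma schur_prefix_augment a b a' b' N : schur_rel a b -> schur_rel a' b' ->
  a' 0%N = a 0%N -> a' 1%N = a 1%N -> (forall k, (k < N)%N -> b' k = b k) ->
  forall k, (k < N.+2)%N -> a' k = a k.
Proof.
move=> hab hab' a0 a1 hbb; elim/ltn_ind => -[|[|k]] IH kN //.
rewrite hab hab' a1; congr (_ * _); apply: eq_bigr => i _.
have ik := ltn_ord i.
by rewrite IH ?hbb//; lia.
Qed.

Lemma convseqC c d : convseq c d =1 convseq d c.
Proof.
move=> k; rewrite /convseq (reindex_inj rev_ord_inj)/=; apply: eq_bigr => i _.
by rewrite subSS mulrC subKn// -ltnS.
Qed.

Lemma taylor_near_ge0 x g b : taylor x g b -> 0 <= Im (b 0%N) ->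
  forall e, 0 < e -> exists2 r, 0 < r & forall z, 0 < Im z ->
     modulus (z - x%:C) < r -> - e <= Im (g z).
Proof.
move=> [G [Gg _ /(expands_bound 1)[B [r [B0 r0 H]]]]] b0 e e0.
have [r' r'0 H'] := small_radius B0 e0.
exists (Num.min r r'); first by rewrite lt_min r0.
move=> z z0; rewrite lt_min => /andP[zr zr'].
have t0 : z - x%:C != 0 by apply: upper_neq0; rewrite Im_add Im_opp subr0.
have := H _ t0 zr; rewrite (addrC x%:C) subrK Gg// expr1.
have -> : ps b (z - x%:C) 1 = b 0%N by rewrite psS /ps big_ord0 add0r mulr1.
have := H' _ zr'; have := Im_le_modulus (g z - b 0%N).
by rewrite Im_add Im_opp ler_norml => /andP[]; lra.
Qed.

Lemma complex_gt0P z : 0 < z <-> Im z = 0 /\ 0 < Re z.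
Proof. by rewrite ltcE /=; split=> [/andP[/eqP -> ->]|[-> ->]]; rewrite ?eqxx. Qed.

Lemma Im_shift z x : Im (z - x%:C) = Im z.
Proof. by rewrite Im_add Im_opp /= subr0. Qed.

Lemma analytic_line_inv (y : R[i]) x z : y != 0 -> z != x%:C ->
  analytic_at (fun w => (y * (w - x%:C))^-1) z.
Proof.
move=> y0 zx; apply: analyticV; last by rewrite mulf_neq0// subr_eq0.
apply: analyticM; first exact: (analytic_cst y z).
apply: analyticB; first exact: analytic_id.
exact: (analytic_cst x%:C z).
Qed.

Definition schur_reduce x (a0 a1 : R[i]) f z :=
  (a1 * (z - x%:C))^-1 - (f z - a0)^-1.

Definition schur_augment x (a0 a1 : R[i]) g z :=
  a0 + ((a1 * (z - x%:C))^-1 - g z)^-1.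

Lemma schur_reduce_taylor x f c : taylor x f c -> c 1%N != 0 ->
  exists2 b, taylor x (schur_reduce x (c 0%N) (c 1%N) f) b & schur_rel c b.
Proof.
move=> [F [Ff Fan hc]] c1.
have hU := expands_unshift hc.
have [d hd cd] := expandsV hU c1.
exists (fun k => - d k.+1); last exact: schur_rel_inverse.
have d0 : d 0%N = (c 1%N)^-1.
  have := cd 0%N; rewrite /convseq big_ord1 subn0/= => h.
  by apply: (mulfI c1); rewrite h mulfV.
exists (schur_reduce x (c 0%N) (c 1%N) F); split.
- by move=> z z0; rewrite /schur_reduce Ff.
- have [e e0 H] := expands_neq0 hU c1; have /dnear_modulusP[e' e'0 H'] := Fan.
  apply/dnear_modulusP; exists (Num.min e e'); first by rewrite lt_min e0.
  move=> z zx; rewrite lt_min => /andP[ze ze'].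
  apply: analyticB; first exact: analytic_line_inv.
  have Fz : F z - c 0%N != 0.
    have := H (z - x%:C); rewrite subr_eq0 (addrC x%:C) subrK => /(_ zx ze).
    by rewrite mulf_eq0 negb_or => /andP[].
  apply: analyticV; last exact: Fz.
  apply: analyticB; first exact: H'.
  exact: (analytic_cst (c 0%N) z).
- apply: eq_expands (expands_unshift (expandsN hd)).
  exists 1 => // t t0 _; rewrite /schur_reduce (addrC x%:C) addrK d0.
  rewrite opprK invf_div mulrDl mulNr invfM [LHS]addrC; congr (_ - _).
  by rewrite mulrAC mulfV// mul1r.
Qed.

(** Since c_0 is real, -1/(f - c_0) has nonnegative imaginary part, which gives the lower bound of
    the minimum principle with A = 1/c_1. At x the constant term of the reduced function is
    c_2/c_1^2, handled by [taylor_Im2_ge0]. *)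
Lemma pick_reduce x f c : pick_class f -> taylor x f c -> Im (c 0%N) = 0 ->
  0 < c 1%N -> pick_class (schur_reduce x (c 0%N) (c 1%N) f).
Proof.
move=> hf hc c0 /complex_gt0P[c1i c1r].
have c1n : c 1%N != 0 by apply: contraTneq c1r => ->; rewrite ltxx.
have fz0 z : 0 < Im z -> f z - c 0%N != 0.
  move=> /(pick_Im_gt0 hf hc c1n) h; apply: upper_neq0.
  by rewrite Im_add Im_opp c0 subr0.
have [b hb rb] := schur_reduce_taylor hc c1n.
have gan : analytic_upper (schur_reduce x (c 0%N) (c 1%N) f).
  move=> z z0; apply: analyticB.
    by apply: analytic_line_inv => //; rewrite -subr_eq0; apply: upper_neq0; rewrite Im_shift.
  apply: analyticV; last exact: fz0.
  apply: analyticB; first exact: (hf _ z0).1.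
  exact: (analytic_cst (c 0%N) z).
have c1E := real_of_Im0 c1i.
move=> z z0; split; first exact: gan.
move: z z0; apply: (@Im_min_principle_pole _ _ x (Re (c 1%N))^-1 gan).
- by rewrite invr_ge0 ltW.
- move=> z z0; rewrite /schur_reduce Im_add Im_opp.
  rewrite c1E invfM -fmorphV Im_scale lerDl.
  by rewrite Im_inv mulNr opprK divr_ge0 ?exprn_ge0 ?modulus_ge0// Im_add Im_opp c0 subr0 (hf _ z0).2.
- apply: (taylor_near_ge0 hb).
  have := taylor_Im2_ge0 hf hc c0 c1i.
  rewrite rb /convseq big_ord1 /= {1 2}c1E !Im_scale.
  by rewrite !pmulr_rge0.
Qed.

(** Rewritten as a_0 + a_1 t/(1 - a_1 t g), the function has a denominator with value 1 at t = 0,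
    which can be inverted as a power series. *)
Lemma schur_augment_taylor x g b (a0 a1 : R[i]) : taylor x g b -> pick_class g ->
  Im a1 = 0 -> 0 < a1 -> 
  exists c, [/\ taylor x (schur_augment x a0 a1 g) c, c 0%N = a0, c 1%N = a1 & schur_rel c b].
Proof.
move=> [G [Gg Gan hb]] hg a1i a1pos.
have a1n : a1 != 0 by rewrite gt_eqF.
have hV := expandsD (expands_cst 1) (expandsZ (- a1) (expands_shift hb)).
have v0 : (if 0%N == 0%N then 1 else 0 : R[i]) + - a1 * shiftseq b 0%N != 0.
  by rewrite /= mulr0 addr0 oner_neq0.
have [d hd cd] := expandsV hV v0.
have hF := expandsD (expands_cst a0) (expands_shift (expandsZ a1 hd)).
have d0 : d 0%N = 1.
  by have := cd 0%N; rewrite /convseq big_ord1 subn0/= mulr0 addr0 mul1r.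
eexists; split.
- exists (fun z => a0 + (z - x%:C) * (a1 * (1 - a1 * ((z - x%:C) * G z))^-1)); split; last first.
  + apply: eq_expands hF; exists 1 => // t _ _.
    by rewrite (addrC x%:C) addrK mulNr.
  + have [e e0 H] := expands_neq0 hV v0; have /dnear_modulusP[e' e'0 H'] := Gan.
    apply/dnear_modulusP; exists (Num.min e e'); first by rewrite lt_min e0.
    move=> z zx; rewrite lt_min => /andP[ze ze'].
    have lin : analytic_at (fun w => w - x%:C) z.
      by apply: analyticB; [exact: analytic_id|exact: (analytic_cst x%:C z)].
    apply: analyticD; first exact: (analytic_cst a0 z).
    apply: analyticM; first exact: lin.
    apply: analyticM; first exact: (analytic_cst a1 z).
    apply: analyticV.
      apply: analyticB; first exact: (analytic_cst 1 z).
      apply: analyticM; first exact: (analytic_cst a1 z).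
      by apply: analyticM; [exact: lin|exact: H'].
    have := H (z - x%:C); rewrite subr_eq0 (addrC x%:C) subrK => /(_ zx ze).
    by rewrite mulNr.
  + move=> z z0; rewrite Gg// /schur_augment; congr (_ + _).
    have t0 : z - x%:C != 0 by apply: upper_neq0; rewrite Im_shift.
    have -> : (a1 * (z - x%:C))^-1 - g z =
        (1 - a1 * ((z - x%:C) * g z)) / (a1 * (z - x%:C)).
      by rewrite mulrBl mul1r mulrA mulrAC mulfV ?mul1r// mulf_neq0.
    by rewrite invf_div mulrA (mulrC a1 (z - x%:C)).
- by rewrite /= addr0.
- by rewrite /= add0r d0 mulr1.
- move=> k; rewrite /= !add0r d0 mulr1; congr (_ * _).
  have := cd k.+1; rewrite {1}/convseq big_ord_recl subn0 /= mulr0 addr0 mul1r => /eqP.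
  rewrite addr_eq0 => /eqP ->; rewrite -sumrN convseqC; apply: eq_bigr => i _.
  by rewrite /= !add0r; ring.
Qed.

Lemma schur_denom_neq0 x g (a1 : R[i]) z : pick_class g -> 0 < a1 -> 0 < Im z ->
  Im ((a1 * (z - x%:C))^-1 - g z) < 0.
Proof.
move=> hg /complex_gt0P[/real_of_Im0 -> a1r] z0.
have t0 : 0 < Im (z - x%:C) by rewrite Im_shift.
rewrite Im_add Im_opp invfM -fmorphV Im_scale Im_inv.
have := (hg _ z0).2.
have : 0 < (Re a1)^-1 * (Im (z - x%:C) / modulus (z - x%:C) ^+ 2).
  by rewrite mulr_gt0 ?invr_gt0// divr_gt0// exprn_gt0// modulus_gt0 upper_neq0.
lra.
Qed.

Lemma pick_augment x g (a0 a1 : R[i]) : pick_class g -> Im a0 = 0 ->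
  0 < a1 -> pick_class (schur_augment x a0 a1 g).
Proof.
move=> hg a0i a1pos z z0.
have neg := schur_denom_neq0 x hg a1pos z0.
have nz : (a1 * (z - x%:C))^-1 - g z != 0 by apply: contraTneq neg => ->; rewrite ltxx.
split; last first.
  rewrite /schur_augment Im_add a0i add0r Im_inv divr_ge0 ?exprn_ge0 ?modulus_ge0//.
  by rewrite oppr_ge0 ltW.
apply: analyticD; first exact: (analytic_cst a0 z).
apply: analyticV; last exact: nz.
apply: analyticB; last exact: (hg _ z0).1.
apply: analytic_line_inv; first by rewrite gt_eqF.
by rewrite -subr_eq0; apply: upper_neq0; rewrite Im_shift.
Qed.

(** N counts the prescribed coefficients a_0, ..., a_(N-1), so that the reduction lowers N by 2 and
    N = 0 imposes no interpolation condition. *)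
Definition taylor_solution N x a f := pick_class f /\
  exists2 c, taylor x f c & forall k, (k < N)%N -> c k = a k.

Definition taylor_unique N x a := exists2 f, taylor_solution N x a f &
  forall g, taylor_solution N x a g -> forall z, 0 < Im z -> g z = f z.

Lemma taylor_solution_reduce N x a b f : Im (a 0%N) = 0 -> 0 < a 1%N -> schur_rel a b ->
  taylor_solution N.+2 x a f -> taylor_solution N x b (schur_reduce x (a 0%N) (a 1%N) f).
Proof.
move=> a0 a1 ab [hf [c hc ca]].
have c0 : c 0%N = a 0%N by exact: ca.
have c1 : c 1%N = a 1%N by exact: ca.
have a1n : a 1%N != 0 by rewrite gt_eqF.
rewrite -c0 -c1; split; first by apply: pick_reduce; rewrite ?c0 ?c1.
have [|b' hb' rb'] := schur_reduce_taylor hc; first by rewrite c1.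
exists b' => //; exact: schur_prefix_reduce ab rb' a1n ca.
Qed.

Lemma taylor_solution_augment N x a b g : Im (a 0%N) = 0 -> 0 < a 1%N -> schur_rel a b ->
  taylor_solution N x b g -> taylor_solution N.+2 x a (schur_augment x (a 0%N) (a 1%N) g).
Proof.
move=> a0 a1 ab [hg [b' hb' bb']]; split; first exact: pick_augment.
have [a1i _] := (complex_gt0P _).1 a1.
have [c [hc c0 c1 rc]] := schur_augment_taylor (a 0%N) hb' hg a1i a1.
by exists c => //; exact: schur_prefix_augment ab rc c0 c1 bb'.
Qed.

(* No denominator has to be nonzero here, because 0^-1 = 0. *)
Lemma augmentK x (a0 a1 : R[i]) g z :
  schur_reduce x a0 a1 (schur_augment x a0 a1 g) z = g z.
Proof. by rewrite /schur_reduce /schur_augment (addrC a0) addrK invrK subKr. Qed.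

Lemma reduceK x (a0 a1 : R[i]) f z :
  schur_augment x a0 a1 (schur_reduce x a0 a1 f) z = f z.
Proof. by rewrite /schur_reduce /schur_augment subKr invrK (addrC a0) subrK. Qed.

(** [schur_reduce] and [schur_augment] are inverse maps between the two sets of solutions. *)
Lemma taylor_unique_schur N x a b : Im (a 0%N) = 0 -> 0 < a 1%N -> schur_rel a b ->
  taylor_unique N.+2 x a <-> taylor_unique N x b.
Proof.
move=> a0 a1 ab; split=> -[f fsol funi].
  exists (schur_reduce x (a 0%N) (a 1%N) f); first exact: taylor_solution_reduce.
  move=> g /(taylor_solution_augment a0 a1 ab) /funi H z z0.
  by rewrite -(augmentK x (a 0%N) (a 1%N) g) /schur_reduce H.
exists (schur_augment x (a 0%N) (a 1%N) f); first exact: taylor_solution_augment.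
move=> g /(taylor_solution_reduce a0 a1 ab) /funi H z z0.
by rewrite -(reduceK x (a 0%N) (a 1%N) g) /schur_augment H.
Qed.

Lemma taylor_solvable_schur N x a b : Im (a 0%N) = 0 -> 0 < a 1%N -> schur_rel a b ->
  (exists f, taylor_solution N.+2 x a f) <-> (exists f, taylor_solution N x b f).
Proof.
move=> a0 a1 ab; split=> -[f fsol].
  by exists (schur_reduce x (a 0%N) (a 1%N) f); exact: taylor_solution_reduce.
by exists (schur_augment x (a 0%N) (a 1%N) f); exact: taylor_solution_augment.
Qed.

End SchurStep.

(** * Solutions when a^0 lies in the open upper half-plane *)

Section InteriorValue.
Variable R : realType.
Implicit Types (z w t u y : R[i]) (a b c d : nat -> R[i]) (e s x M : R).
Implicit Types (f g F G : R[i] -> R[i]).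
Local Open Scope classical_set_scope.

Lemma expands_shiftn K c f : expands c f ->
  expands (fun k => if (k < K)%N then 0 else c (k - K)%N) (fun t => t ^+ K * f t).
Proof.
move=> hc; elim: K => [|K IH].
  apply: eq_expands (_ : expands _ f).
    by exists 1 => // t _ _; rewrite expr0 mul1r.
  have -> // : (fun k => if (k < 0)%N then 0 else c (k - 0)%N) = c.
  by apply/funext => k; rewrite subn0.
have := expands_shift IH.
rewrite (_ : shiftseq _ = (fun k => if (k < K.+1)%N then 0 else c (k - K.+1)%N)).
  by apply: eq_expands; exists 1 => // t _ _; rewrite exprS mulrA.
by apply/funext => -[|k]; rewrite //= ltnS subSS.
Qed.

(* t / (1 - i M t) maps the upper half-plane into the disc of radius 1/M. *)
Lemma modulus_denominator M t : 0 <= M -> 0 < Im t ->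
  M * modulus t <= modulus (1 - 'i * M%:C * t).
Proof.
move=> M0 t0.
rewrite -(ler_pXn2r (n := 2)) ?nnegrE ?mulr_ge0 ?modulus_ge0//.
rewrite exprMn !modulus_sqr Re_add Im_add Re_opp Im_opp !Re_mul !Im_mul /=.
have : 0 <= M * Im t by rewrite mulr_ge0// ltW.
nra.
Qed.

(* The coefficients are corrected one at a time: adding y (t/(1 - i M t))^(N+1)
   does not affect the lower ones and changes f by at most |y|/M. *)
Lemma interior_taylor_solution N x a : 0 < Im (a 0%N) -> exists f, taylor_solution N x a f.
Proof.
move=> a0.
(* The induction carries a uniform lower bound e for Im f, of which each correction uses up at most
   half, and analyticity on a full disc about x. *)
suff [f [c [e [e0 fpick [r r0 fx] hc ca]]]] : exists f c e, [/\ 0 < e,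
    (forall z, 0 < Im z -> analytic_at f z /\ e <= Im (f z)),
    (exists2 r : R, 0 < r & forall z, modulus (z - x%:C) < r -> analytic_at f z),
    expands c (fun t => f (x%:C + t))
    & forall k, (k < N.+1)%N -> c k = a k].
  exists f; split=> [z z0|]; first by have [? ?] := fpick z z0; split=> //; lra.
  exists c => [|k kN]; last by rewrite ca// ltnW.
  exists f; split=> //.
  by apply/dnear_modulusP; exists r => // w _; exact: fx.
elim: N => [|N [f [c [e [e0 fpick [r r0 fx] hc ca]]]]].
  exists (fun=> a 0%N), (fun k => if k == 0%N then a 0%N else 0), (Im (a 0%N)).
  split=> //.
  - by move=> z z0; split; first exact: (analytic_cst (a 0%N) z).
  - by exists 1; [exact: ltr01|move=> z _; exact: (analytic_cst (a 0%N) z)].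
  - exact: expands_cst.
  - by move=> [|k].
pose y := a N.+1 - c N.+1.
(* This makes |y|/M at most e/2; the summand 1 gives M >= 1, so that powers of a number below 1/M
   stay below 1/M. *)
pose M : R := 2 * modulus y / e + 1.
have M1 : 1 <= M by rewrite /M lerDr divr_ge0 ?mulr_ge0 ?modulus_ge0 ?ltW.
pose D w : R[i] := 1 - 'i * M%:C * (w - x%:C).
pose h w : R[i] := y * (D w)^-1 ^+ N.+1.
have D_an z : analytic_at D z.
  apply: analyticB; first exact: (analytic_cst 1 z).
  apply: analyticM; first exact: (analytic_cst ('i * M%:C) z).
  by apply: analyticB; [exact: analytic_id|exact: (analytic_cst x%:C z)].
have h_an z : D z != 0 -> analytic_at h z.
  move=> Dz; apply: analyticM; first exact: (analytic_cst y z).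
  by apply: analyticX; apply: analyticV; [exact: D_an|exact: Dz].
pose g w : R[i] := (w - x%:C) ^+ N.+1 * h w.
have g_an z : D z != 0 -> analytic_at g z.
  move=> Dz; apply: analyticM; last exact: h_an.
  apply: analyticX.
  by apply: analyticB; [exact: analytic_id|exact: (analytic_cst x%:C z)].
have Dupper z : 0 < Im z -> M * modulus (z - x%:C) <= modulus (D z).
  by move=> z0; apply: modulus_denominator; [lra|rewrite Im_shift].
have D0 z : 0 < Im z -> D z != 0.
  move=> z0; rewrite -modulus_gt0; apply: lt_le_trans (Dupper z z0).
  by rewrite mulr_gt0 ?modulus_gt0 ?upper_neq0 ?Im_shift//; lra.
have mi : modulus ('i : R[i]) = 1 by rewrite /= expr0n expr1n add0r sqrtr1.
have Dx z : modulus (z - x%:C) < M^-1 -> D z != 0.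
  move=> zM; apply: contraTneq zM => /eqP; rewrite /D subr_eq0 => /eqP D1.
  have := congr1 (@modulus R) D1; rewrite modulus1 !modulusM mi mul1r modulus_real.
  rewrite gtr0_norm; last by lra.
  by move=> m1; rewrite -leNgt -(ler_pM2l (_ : 0 < M)) -?m1 ?mulfV ?gt_eqF//; lra.
have gsmall z : 0 < Im z -> modulus (g z) <= e / 2.
  move=> z0; rewrite /g /h mulrCA -exprMn modulusM modulusX.
  set q := modulus (_ / _).
  have qM : q <= M^-1.
    rewrite /q modulusM modulusV ler_pdivrMr ?modulus_gt0 ?D0//.
    by rewrite ler_pdivlMl ?Dupper//; lra.
  have q0 : 0 <= q by exact: modulus_ge0.
  have qM' : q ^+ N.+1 <= M^-1.
    apply: (le_trans _ qM); rewrite exprS ler_piMr// exprn_ile1//.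
    by apply: (le_trans qM); rewrite invf_le1//; lra.
  apply: (le_trans (ler_wpM2l (modulus_ge0 y) qM')).
  rewrite ler_pdivrMr; last by lra.
  rewrite (_ : e / 2 * M = modulus y + e / 2); last first.
    by rewrite /M; field; rewrite gt_eqF.
  by rewrite lerDl divr_ge0// ltW.
have [d d0 hd] : exists2 d, d 0%N = h x%:C & expands d (fun t => h (x%:C + t)).
  apply/analytic_atP; apply: h_an; apply: Dx.
  by rewrite subrr modulus0 invr_gt0; lra.
have hg := expands_shiftn N.+1 hd.
have hfg := expandsD hc hg.
exists (fun z => f z + g z).
exists (fun k => c k + (if (k < N.+1)%N then 0 else d (k - N.+1)%N)), (e / 2).
split.
- by lra.
- move=> z z0; have [fan fe] := fpick z z0; split.
    by apply: analyticD; [exact: fan|apply: g_an; exact: D0].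
  have := Im_le_modulus (g z); have := gsmall z z0.
  by rewrite ler_norml Im_add => h1 /andP[]; lra.
- exists (Num.min r M^-1); first by rewrite lt_min r0 invr_gt0; lra.
  move=> z; rewrite lt_min => /andP[zr zM].
  by apply: analyticD; [exact: fx|apply: g_an; exact: Dx].
- apply: eq_expands hfg; exists 1 => // t _ _.
  by rewrite /g (addrC x%:C) addrK.
- move=> k; rewrite ltnS leq_eqVlt => /orP[/eqP ->|kN]; last by rewrite kN addr0 ca.
  rewrite ltnn subnn d0 /h /D subrr mulr0 subr0 invr1 expr1n mulr1 /y.
  by rewrite addrC subrK.
Qed.

End InteriorValue.

(** * Laurent expansions and removal of the pole *)

Section Laurent.
Variable R : realType.
Implicit Types (z w t u y : R[i]) (b d : nat -> R[i]) (e s x : R).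
Implicit Types (f g F G : R[i] -> R[i]) (c : int -> R[i]) (k : int).
Local Open Scope classical_set_scope.

Lemma series_mul_cvg (v v' : nat -> R[i]) y y' : (forall j, v' j = y * v j) ->
  series v @ \oo --> y' -> series v' @ \oo --> y * y'.
Proof.
move=> vv hv; rewrite (_ : series v' = (fun n => y * series v n)).
  exact: (cvgM (cvg_cst y) hv).
by apply/funext => n; rewrite /series /= mulr_sumr; apply: eq_bigr => i _.
Qed.

Lemma laurent_expands F x c : laurent_at F x%:C c -> exists N : nat,
  (forall k, k < - N%:Z -> c k = 0) /\
  expands (fun j : nat => c (j%:Z - N%:Z)) (fun t => t ^+ N * F (x%:C + t)).
Proof.
move=> [N [cN /dnear_modulusP[e e0 H]]]; exists N; split=> //; exists e => // t t0 te.
have := H (x%:C + t); rewrite -subr_eq0 (addrC x%:C) addrK => /(_ t0 te) h.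
rewrite psum_seriesE; apply: series_mul_cvg h => j.
rewrite mulrCA; congr (_ * _).
by rewrite !exprnP -expfzDr// addrC subrK.
Qed.

(** Further factors t pad the sequence with zeros, which brings two expansions with different bounds
    on the pole to a common form. *)
Lemma laurent_expandsW F x c N K : (N <= K)%N -> (forall k, k < - N%:Z -> c k = 0) ->
  expands (fun j : nat => c (j%:Z - N%:Z)) (fun t => t ^+ N * F (x%:C + t)) ->
  expands (fun j : nat => c (j%:Z - K%:Z)) (fun t => t ^+ K * F (x%:C + t)).
Proof.
move=> /subnK <- cN; elim: (K - N)%N => [//|m IH] /IH /expands_shift.
rewrite (_ : shiftseq _ = (fun j : nat => c (j%:Z - (m.+1 + N)%N%:Z))).
  by apply: eq_expands; exists 1 => // t _ _; rewrite addSn exprS mulrA.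
apply/funext => -[|j] /=; first by rewrite cN//; lia.
by congr c; lia.
Qed.

Lemma laurent_expansion_inj f x c c' :
  laurent_expansion f x c -> laurent_expansion f x c' -> c =1 c'.
Proof.
move=> [F [Ff _ /laurent_expands[N [cN hc]]]].
move=> [F' [Ff' _ /laurent_expands[N' [cN' hc']]]].
pose K := maxn N N'.
have h := laurent_expandsW (leq_maxl N N') cN hc.
have h' := laurent_expandsW (leq_maxr N N') cN' hc'.
have cc : (fun j : nat => c (j%:Z - K%:Z)) =1 (fun j : nat => c' (j%:Z - K%:Z)).
  apply: expands_inj (@cone_upper R) _ h h' _.
    by exists 'i => /=; [exact: ltr01|apply: upper_neq0 => /=; exact: ltr01].
  exists 1 => // t t0 _ _; congr (_ * _).
  have xt : upper_half_plane (x%:C + t) by rewrite upperP Im_real_shift.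
  by rewrite Ff ?Ff'.
move=> k; have [kK|kK] := ltP k (- K%:Z).
  by rewrite cN ?cN'//; move: kK; rewrite /K; lia.
have := cc (absz (k + K%:Z)); rewrite gez0_abs ?addrK//; lia.
Qed.

Lemma laurent_coefE f x c k : laurent_expansion f x c -> laurent_coef k f x = c k.
Proof.
move=> hc; rewrite /laurent_coef; case: xgetP => [l -> [c' hc' <-]|/(_ (c k))].
  exact: laurent_expansion_inj hc' hc k.
by case; exists c.
Qed.

(** A leading term y/u^p with p > 1 would have nonnegative imaginary part on the half-plane. As Im
    (y/w) = Im (- conj(y) w)/|w|^2, the directions found for the positive power u^p also exclude the
    negative one. *)
Lemma pick_pole_order f F x c N : pick_class f ->
  (forall z, upper_half_plane z -> F z = f z) ->
  expands (fun j : nat => c (j%:Z - N.+1%:Z)) (fun t => t ^+ N.+1 * F (x%:C + t)) ->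
  forall j : nat, (j < N)%N -> c (j%:Z - N.+1%:Z) = 0.
Proof.
move=> hf Ff hc; elim/ltn_ind => j IH jN; apply/eqP/negPn/negP => cj.
set y := c _ in cj; pose p := (N.+1 - j)%N.
have p1 : (1 < p)%N by rewrite /p; lia.
have lead u : 0 < Im u -> 0 <= Im (y * u ^+ j / u ^+ N.+1).
  move=> u0.
  have := leading_term_Im (p := N.+1) (j := j) (@cone_upper R) hc _ _ u0 (upper_neq0 u0).
  apply; last by move=> i ij; apply: IH => //; exact: ltn_trans jN.
  exists 1 => // t t0 tn0 _; rewrite mulrAC mulfV ?expf_neq0// mul1r.
  have xt : upper_half_plane (x%:C + t) by rewrite upperP Im_real_shift.
  by rewrite Ff//; exact: (hf _ xt).2.
have [||u u0] := @power_Im_neg_upper R (- y^*) p; rewrite ?oppr_eq0 ?conjc_eq0//.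
have := lead u u0.
have -> : y * u ^+ j / u ^+ N.+1 = y * (u ^+ p)^-1.
  rewrite (_ : N.+1 = (j + p)%N); last by rewrite /p; lia.
  by rewrite exprD; field; rewrite !expf_neq0 ?upper_neq0.
have W0 : 0 < modulus (u ^+ p) ^+ 2.
  by rewrite exprn_gt0// modulus_gt0 expf_neq0// upper_neq0.
have -> : Im (y / u ^+ p) = Im (- y^* * u ^+ p) / modulus (u ^+ p) ^+ 2.
  rewrite Im_mul Re_inv Im_inv; move: (u ^+ p) (modulus _ ^+ 2) => [r s] m.
  by case: (y) => a b; rewrite Im_mul /=; ring.
by rewrite pmulr_lge0 ?invr_gt0// leNgt => /negP.
Qed.

(** From Im f >= 0 the difference inherits the lower bound - a^{-1} Im (1/(z - x)), and its constant
    term at x is a^0. With a^{-1} <= 0 and Im a^0 >= 0 these are the two hypotheses of the minimum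
    principle. *)
Lemma solution_taylor_solution N x (a : seq R[i]) f : size a = N.+2 -> Im a`_0 = 0 -> Re a`_0 <= 0 ->
  0 <= Im (term a 0) -> solution x a f ->
  taylor_solution N.+1 x (term a) (fun z => f z - a`_0 / (z - x%:C)).
Proof.
move=> sa a0i a0r ta0 [hf [c hc] ca].
have {}ca j : (j < N.+2)%N -> c (j%:Z - 1) = a`_j.
  by rewrite -sa => /ca <-; rewrite (laurent_coefE _ hc).
have cm1 : c (-1) = a`_0 by have := ca 0%N isT; rewrite sub0r.
have [F [Ff Fan /laurent_expands[N' [cN hF]]]] := hc.
have {}hF := laurent_expandsW (leqnSn N') cN hF.
have low := pick_pole_order hf Ff hF.
have hb : taylor x (fun z => f z - a`_0 / (z - x%:C)) (fun j => c j%:Z).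
  exists (fun z => F z - a`_0 / (z - x%:C)); split.
  - by move=> z z0; rewrite Ff.
  - have /dnear_modulusP[e e0 H] := Fan; apply/dnear_modulusP; exists e => [//|w wx we].
    apply: analyticB; first exact: H.
    apply: analyticM; first exact: (analytic_cst a`_0 w).
    apply: analyticV; last by rewrite subr_eq0.
    by apply: analyticB; [exact: analytic_id|exact: (analytic_cst x%:C w)].
  - have := expands_unshiftn N'.+1 hF.
    rewrite (_ : (fun k : nat => c _) = (fun j : nat => c j%:Z)); last first.
      by apply/funext => j; congr c; lia.
    apply: eq_expands; exists 1 => // t t0 _.
    rewrite (addrC x%:C) addrK psS /ps big1 => [|i _]; last by rewrite low ?mul0r.
    rewrite (_ : N'%:Z - N'.+1%:Z = -1) ?cm1; last by lia.
    rewrite add0r mulrBl mulrAC mulfV ?expf_neq0// mul1r; congr (_ - _).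
    by rewrite exprS; field; rewrite t0 expf_neq0.
have cterm (k : nat) : (k < N.+1)%N -> c k%:Z = term a k.
  by move=> kN; rewrite /term -ca//; congr c; lia.
have b0 : 0 <= Im (c 0%:Z) by rewrite cterm.
split; last by exists (fun j => c j%:Z).
have a0E := real_of_Im0 a0i.
have gan : analytic_upper (fun z => f z - a`_0 / (z - x%:C)).
  move=> z z0; apply: analyticB; first exact: (hf _ z0).1.
  apply: analyticM; first exact: (analytic_cst a`_0 z).
  apply: analyticV; last by apply: upper_neq0; rewrite Im_shift.
  by apply: analyticB; [exact: analytic_id|exact: (analytic_cst x%:C z)].
move=> z z0; split; first exact: gan.
move: z z0; apply: (@Im_min_principle_pole _ _ x (- Re a`_0) gan).
- by rewrite oppr_ge0.
- move=> z z0; rewrite Im_add Im_opp {2}a0E Im_scale mulNr lerDr.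
  exact: (hf _ z0).2.
- exact: (taylor_near_ge0 hb b0).
Qed.

Lemma taylor_solution_solution N x (a : seq R[i]) g : size a = N.+2 -> Im a`_0 = 0 -> Re a`_0 <= 0 ->
  taylor_solution N.+1 x (term a) g -> solution x a (fun z => g z + a`_0 / (z - x%:C)).
Proof.
move=> sa a0i a0r [hg [b [G [Gg Gan hb]] ba]].
(* [Negz 0] is the index -1. *)
pose c (k : int) : R[i] := match k with Posz j => b j | Negz 0 => a`_0 | Negz _ => 0 end.
have hc : laurent_expansion (fun z => g z + a`_0 / (z - x%:C)) x c.
  exists (fun z => G z + a`_0 / (z - x%:C)); split.
  - by move=> z z0; rewrite Gg.
  - have /dnear_modulusP[e e0 H] := Gan; apply/dnear_modulusP; exists e => [//|w wx we].
    apply: analyticD; first exact: H.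
    apply: analyticM; first exact: (analytic_cst a`_0 w).
    apply: analyticV; last by rewrite subr_eq0.
    by apply: analyticB; [exact: analytic_id|exact: (analytic_cst x%:C w)].
  - exists 1%N; split=> [[j|[|j]]|]; [lia|lia|by []|].
    have [e e0 H] := expandsD (expands_cst a`_0) (expands_shift hb).
    apply/dnear_modulusP; exists e => [//|w wx we].
    have t0 : w - x%:C != 0 by rewrite subr_eq0.
    have := H _ t0 we; rewrite (addrC x%:C) subrK psum_seriesE => h.
    rewrite (_ : G w + _ = (w - x%:C)^-1 * (a`_0 + (w - x%:C) * G w)); last first.
      by rewrite mulrDr mulrA mulVf// mul1r addrC mulrC.
    apply: series_mul_cvg h => j; rewrite mulrCA; congr (_ * _); last first.
      by rewrite expfzDr// -exprnP exprN1 mulrC.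
    case: j => [|j]; first by rewrite /= addr0.
    have -> : c (j.+1%:Z - 1%:Z) = c j%:Z by congr c; lia.
    by rewrite /= add0r.
split; last first.
- move=> j; rewrite (laurent_coefE _ hc) sa; case: j => [//|j].
  rewrite ltnS => /ba bj; rewrite -[a`_j.+1]/(term a j) -bj.
  have -> : c (j.+1%:Z - 1) = c j%:Z by congr c; lia.
  by [].
- by exists c.
- move=> z z0; have [gan gi] := hg z z0; split.
    apply: analyticD; first exact: gan.
    apply: analyticM; first exact: (analytic_cst a`_0 z).
    apply: analyticV; last by apply: upper_neq0; rewrite Im_shift.
    by apply: analyticB; [exact: analytic_id|exact: (analytic_cst x%:C z)].
  rewrite Im_add addr_ge0// (real_of_Im0 a0i) Im_scale Im_inv Im_shift.
  rewrite mulNr mulrN -mulNr mulr_ge0 ?oppr_ge0// divr_ge0 ?exprn_ge0 ?modulus_ge0//.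
  exact: ltW.
Qed.

Lemma solvableE N x (a : seq R[i]) : size a = N.+2 -> Im a`_0 = 0 -> Re a`_0 <= 0 ->
  0 <= Im (term a 0) -> solvable x a <-> exists f, taylor_solution N.+1 x (term a) f.
Proof.
move=> sa a0i a0r ta0; split=> -[f hf].
  by eexists; exact: solution_taylor_solution hf.
by eexists; exact: taylor_solution_solution hf.
Qed.

Lemma uniquely_solvableE N x (a : seq R[i]) : size a = N.+2 -> Im a`_0 = 0 ->
  Re a`_0 <= 0 -> 0 <= Im (term a 0) -> uniquely_solvable x a <-> taylor_unique N.+1 x (term a).
Proof.
move=> sa a0i a0r ta0; split=> -[f hf uni].
  eexists; first exact: solution_taylor_solution hf.
  move=> g /(taylor_solution_solution sa a0i a0r)/uni H z z0.
  by rewrite -(H z z0) addrK.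
eexists; first exact: taylor_solution_solution hf.
move=> g /(solution_taylor_solution sa a0i a0r ta0)/uni H z z0.
by rewrite -(H z z0) subrK.
Qed.

End Laurent.


Local Open Scope sesquilinear_scope.
Local Open Scope ring_scope.

(** * Quadratic forms of complex matrices *)

Section QuadraticForm.
Variable C : numClosedFieldType.

Definition qform m (M : 'M[C]_m) (v : 'cV[C]_m) : C := (v ^t* *m M *m v) 0 0.

Lemma qformE m (M : 'M[C]_m) v :
  qform M v = \sum_i \sum_j (v i 0)^* * M i j * v j 0.
Proof.
rewrite /qform !mxE exchange_big /=; apply: eq_bigr => j _.
by rewrite mxE mulr_suml; apply: eq_bigr => i _; rewrite !mxE.
Qed.

Lemma qformB m (M M' : 'M[C]_m) v : qform (M - M') v = qform M v - qform M' v.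
Proof. by rewrite /qform mulmxBr mulmxBl !mxE. Qed.

Lemma qform0 m (v : 'cV[C]_m) : qform 0 v = 0.
Proof. by rewrite /qform mulmx0 mul0mx mxE. Qed.

(** The form is sesquilinear; for real V the transpose is the adjoint. *)
Lemma qform_congr m (V D : 'M[C]_m) v : V \is a realmx ->
  qform (V *m D *m V^T) v = qform D (V^T *m v).
Proof.
move=> Vr; rewrite /qform trmx_mul trmxK map_mxM/= (realmxC Vr).
by rewrite !mulmxA.
Qed.

Lemma qform_block m (r : C) (H : 'M[C]_m) (v : 'cV[C]_(1 + m)) :
  qform (block_mx r%:M 0 0 H) v =
  r * ((v 0 0)^* * v 0 0) + qform H (dsubmx v).
Proof.
rewrite -{1}(vsubmxK v) /qform tr_col_mx map_row_mx mul_row_block !mulmx0 addr0 add0r.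
rewrite mul_row_col mxE; congr (_ + _).
rewrite !mxE big_ord1 !mxE big_ord1 !mxE mulr1n mulrAC mulrC.
by rewrite (_ : lshift m 0 = 0)//; apply: val_inj.
Qed.

Lemma qform_real_axis m (H : 'M[C]_m) (i j : 'I_m) (s : C) : i != j ->
  s \is Num.real -> H j i = H i j ->
  qform H (s *: delta_mx i 0 + delta_mx j 0) = s ^+ 2 * H i i + s * H i j *+ 2 + H j j.
Proof.
move=> ij sr Hs.
have dl k l : (delta_mx k 0 : 'cV[C]_m)^T *m H *m delta_mx l 0 = (H k l)%:M.
  rewrite trmx_delta -rowE -colE; apply/matrixP => a b.
  by rewrite !ord1 !mxE mulr1n.
have ve : ((s *: delta_mx i 0 + delta_mx j 0 : 'cV[C]_m) ^t*) =
    s *: (delta_mx i 0)^T + (delta_mx j 0)^T.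
  by apply/matrixP => a b; rewrite !mxE rmorphD rmorphM/= conj_Creal// !rmorph_nat.
rewrite /qform ve !mulmxDl !mulmxDr -!scalemxAl -!scalemxAr !dl Hs !mxE /=.
by rewrite !mulr1n; ring.
Qed.

End QuadraticForm.

(** * The congruence between the Hankel matrices of a and b *)

Section HankelSchur.
Variable R : realType.
Local Notation C := R[i].
Implicit Types (a b : nat -> C).

Definition hankel_seq a m : 'M[C]_m := \matrix_(i < m, j < m) a (i + j).+1.

(** The matrix of multiplication by (f - a_0)/t on coefficient sequences: lower triangular with a_1
    on the diagonal. *)
Definition toeplitz a (i j : nat) : C := if (j <= i)%N then a (i - j).+1 else 0.

Lemma toeplitz_sum a m i (F : nat -> C) : (i <= m)%N ->
  \sum_(l < m) toeplitz a i l.+1 * F l = \sum_(l < i) a (i - l)%N * F l.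
Proof.
move=> im; rewrite (big_ord_widen m (fun l => a (i - l)%N * F l) im) [RHS]big_mkcond.
apply: eq_bigr => l _; rewrite /toeplitz; case: ifP => li; last by rewrite mul0r.
by rewrite -subSn// subSS.
Qed.

(* With F = f - a_0 = 1/(1/(a_1 z) - g), this is the coefficient of z^i w^j in
   (f(z) - f(w))/(z - w) = F(z) F(w) (1/(a_1 z w) + (g(z) - g(w))/(z - w)). *)
Lemma hankel_identity a b i j : a 1%N != 0 -> schur_rel a b ->
  a (i + j).+1 = a i.+1 * a j.+1 / a 1%N +
    \sum_(l < i) a (i - l)%N * \sum_(l' < j) a (j - l')%N * b (l + l').+1.
Proof.
move=> a1 ab.
have rel k : a k.+2 / a 1%N = a k.+1 * b 0%N + \sum_(l < k) a (k - l)%N * b l.+1.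
  rewrite ab mulrAC mulfV// mul1r convseqC /convseq big_ord_recl subn0 mulrC.
  congr (_ + _); apply: eq_bigr => l _.
  by rewrite lift0 mulrC subnSK.
pose S i j := \sum_(l < i) a (i - l)%N * \sum_(l' < j) a (j - l')%N * b (l + l').+1.
elim: i j => [|i IH] j; first by rewrite big_ord0 addr0 mulrAC mulfV// mul1r.
rewrite addSnnS IH -/(S i j.+1) -/(S i.+1 j).
(* The double sums for (i, j+1) and (i+1, j) share T; they differ by single sums, which [rel] turns
   into coefficients of a. *)
pose T := \sum_(l < i) a (i - l)%N * \sum_(l' < j) a (j - l')%N * b (l + l').+2.
have -> : S i j.+1 = a j.+1 * (\sum_(l < i) a (i - l)%N * b l.+1) + T.
  rewrite /S /T mulr_sumr -big_split /=; apply: eq_bigr => l _.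
  rewrite big_ord_recl subn0 addn0 mulrDr mulrCA; congr (_ + _ * _).
  by apply: eq_bigr => l' _; rewrite lift0 subSS addnS.
have -> : S i.+1 j = a i.+1 * (\sum_(l < j) a (j - l)%N * b l.+1) + T.
  by rewrite /S /T big_ord_recl subn0; congr (_ + _).
by rewrite -mulrA rel [a i.+2 * _ / _]mulrAC rel; ring.
Qed.

Lemma hankel_seq_congr a b m : a 1%N != 0 -> schur_rel a b ->
  hankel_seq a m.+1 = (\matrix_(i < 1 + m, j < 1 + m) toeplitz a i j) *m
    block_mx (a 1%N)^-1%:M 0 0 (hankel_seq b m) *m
    (\matrix_(i < 1 + m, j < 1 + m) toeplitz a i j)^T.
Proof.
move=> a1 ab; set L := (X in X *m _ *m _); set D := block_mx _ _ _ _.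
have LE (i j : 'I_(1 + m)) : L i j = toeplitz a i j by rewrite mxE.
have LD0 (i : 'I_(1 + m)) : (L *m D) i (lshift m 0) = toeplitz a i 0 * (a 1%N)^-1.
  rewrite mxE big_split_ord /= big_ord1 LE block_mxEul mxE mulr1n big1 ?addr0// => k _.
  by rewrite LE block_mxEdl mxE mulr0.
have LD1 (i : 'I_(1 + m)) (l : 'I_m) : (L *m D) i (rshift 1 l) =
    \sum_(k < m) toeplitz a i k.+1 * b (k + l).+1.
  rewrite mxE big_split_ord /= big_ord1 LE block_mxEur mxE mulr0 add0r.
  by apply: eq_bigr => k _; rewrite LE block_mxEdr mxE.
apply/matrixP => i j; rewrite [LHS]mxE (hankel_identity i j a1 ab).
rewrite [RHS]mxE big_split_ord /= big_ord1 LD0 mxE LE.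
congr (_ + _); first by rewrite /toeplitz /= !subn0; ring.
have im : (i <= m)%N by rewrite -ltnS; exact: (ltn_ord i).
have jm : (j <= m)%N by rewrite -ltnS; exact: (ltn_ord j).
rewrite -(toeplitz_sum a (fun l => \sum_(l' < j) a (j - l')%N * b (l + l').+1) im).
have e l : \sum_(l' < j) a (j - l')%N * b (l + l').+1 =
    \sum_(l' < m) toeplitz a j l'.+1 * b (l + l').+1.
  by rewrite (toeplitz_sum a (fun l' => b (l + l').+1) jm).
transitivity (\sum_(l < m) \sum_(l' < m)
    toeplitz a i l.+1 * (toeplitz a j l'.+1 * b (l + l').+1)).
  by apply: eq_bigr => l _; rewrite e mulr_sumr.
rewrite exchange_big; apply: eq_bigr => l' _ /=.
rewrite LD1 mxE LE mulr_suml; apply: eq_bigr => l _.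
by rewrite [toeplitz a j (_ + _)]/(toeplitz a j l'.+1); ring.
Qed.

End HankelSchur.


(** * Positivity and SE-minimality under the reduction *)

Section HankelPositivity.
Variable R : realType.
Local Notation C := R[i].
Implicit Types (a b : nat -> C) (e r : R).

Lemma normsq_ge0 (z : C) : 0 <= z^* * z.
Proof. by rewrite mulrC mul_conjC_ge0. Qed.

Lemma normsq_gt0 (z : C) : (0 < z^* * z) = (z != 0).
Proof. by rewrite mulrC mul_conjC_gt0. Qed.

Lemma realIm (z : C) : z \is Num.real -> Im z = 0.
Proof. by move=> /complex_realP[r ->]. Qed.

Lemma Im_real (z : C) : Im z = 0 -> z \is Num.real.
Proof. by move=> /real_of_Im0 ->; apply/complex_realP; exists (Re z). Qed.

Definition real_below N a := forall k, (k < N)%N -> a k \is Num.real.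

Lemma schur_rel_last a b k : schur_rel a b ->
  a k.+2 = a 1%N * (\sum_(i < k) a i.+2 * b (k - i.+1)%N) + a 1%N ^+ 2 * b k.
Proof.
move=> ab; rewrite ab /convseq big_ord_recl subn0 mulrDr addrC; congr (_ + _).
by rewrite expr2 mulrA.
Qed.

Lemma schur_partial_real a b k : real_below k.+2 a -> real_below k b ->
  a 1%N * (\sum_(i < k) a i.+2 * b (k - i.+1)%N) \is Num.real.
Proof.
move=> ra rb; apply: rpredM; first exact: ra.
by apply: rpred_sum => i _; have := ltn_ord i => ik; apply: rpredM; [apply: ra|apply: rb]; lia.
Qed.

Lemma schur_real a b N : schur_rel a b -> a 1%N != 0 -> real_below N.+2 a -> real_below N b.
Proof.
move=> ab a1 ra; elim/ltn_ind => k IH kN.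
have h := schur_rel_last k ab.
have -> : b k = (a k.+2 - a 1%N * (\sum_(i < k) a i.+2 * b (k - i.+1)%N)) / a 1%N ^+ 2.
  by rewrite h addrC addKr mulrAC mulfV ?mul1r// expf_neq0.
apply: rpredM; last by rewrite rpredV rpredX// ra.
rewrite rpredB ?ra//; apply: schur_partial_real => i ik; first by apply: ra; lia.
by apply: IH => //; lia.
Qed.

(** All terms of the recursion but a_1^2 b_k are real, so the first nonreal coefficient moves down
    two places and keeps the sign of its imaginary part. *)
Lemma schur_Im a b k : schur_rel a b -> real_below k.+2 a -> real_below k b ->
  Im (a k.+2) = Re (a 1%N) ^+ 2 * Im (b k).
Proof.
move=> ab ra rb; rewrite (schur_rel_last k ab) Im_add.
rewrite (realIm (schur_partial_real ra rb)) add0r.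
by rewrite (real_of_Im0 (realIm (ra 1%N isT))) -rmorphXn Im_scale.
Qed.

Lemma hankel_seq_entry_real a m : real_below (2 * m) a ->
  forall i j : 'I_m, a (i + j).+1 \is Num.real.
Proof. by move=> ra i j; apply: ra; have := ltn_ord i; have := ltn_ord j; lia. Qed.

Lemma hankel_seq_herm a m : real_below (2 * m) a -> hankel_seq a m \is hermsymmx.
Proof.
move=> ra; apply/is_hermitianmxP; rewrite expr0 scale1r.
apply/matrixP => i j; rewrite !mxE addnC conj_Creal//.
exact: hankel_seq_entry_real ra j i.
Qed.

Lemma posdef_hankel_seq a m : real_below (2 * m) a ->
  posdef (hankel_seq a m) <-> (forall v, v != 0 -> 0 < qform (hankel_seq a m) v).
Proof. by move=> /hankel_seq_herm h; split=> [[]|]. Qed.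

(* M - diag(0, ..., 0, e) is positive semidefinite. *)
Definition semidef m (M : 'M[C]_m.+1) e := forall v : 'cV[C]_m.+1,
  e%:C * ((v ord_max 0)^* * v ord_max 0) <= qform M v.

Definition corner m e : 'M[C]_m.+1 :=
  diag_mx (\row_(j < m.+1) if j.+1 == m.+1 then e%:C else 0).

Lemma qform_corner m e v :
  qform (corner m e) v = e%:C * ((v ord_max 0)^* * v ord_max 0).
Proof.
rewrite /qform /corner mul_mx_diag mxE (bigD1 ord_max)//= big1 ?addr0.
  by rewrite !mxE eqxx mulrAC mulrC mulrA.
move=> i im; rewrite !mxE; case: eqP => [[h]|_]; last by rewrite mulr0 mul0r.
by move: im; rewrite (_ : i = ord_max) ?eqxx//; apply: val_inj.
Qed.

Lemma corner_herm m e : corner m e \is hermsymmx.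
Proof.
apply/is_hermitianmxP; rewrite expr0 scale1r; apply/matrixP => i j.
rewrite !mxE; have [->|ij] := eqVneq i j; last by rewrite !mulr0n conjC0.
rewrite mulr1n; case: ifP => _; rewrite ?conjC0// conj_Creal//.
by apply/complex_realP; exists e.
Qed.

Lemma SE_hankel_seq a m : real_below (2 * m.+1) a -> SE_minimally_positive (hankel_seq a m.+1) <->
  semidef (hankel_seq a m.+1) 0 /\ forall e, 0 < e -> ~ semidef (hankel_seq a m.+1) e.
Proof.
move=> /hankel_seq_herm hM.
have psd e : possemidef (hankel_seq a m.+1 - corner m e) <-> semidef (hankel_seq a m.+1) e.
  split=> [[_ h] v|h].
    by have := h v; rewrite -/(qform _ v) qformB qform_corner subr_ge0.
  split; last by move=> v; rewrite -/(qform _ v) qformB qform_corner subr_ge0.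
  have /is_hermitianmxP := hM; have /is_hermitianmxP := corner_herm m e.
  rewrite !expr0 !scale1r => h1 h2; apply/is_hermitianmxP; rewrite expr0 scale1r.
  by rewrite {1}h1 {1}h2; apply/matrixP => i j; rewrite !mxE rmorphB.
have psd0 : possemidef (hankel_seq a m.+1) <-> semidef (hankel_seq a m.+1) 0.
  by split=> [[_ h] v|h]; [rewrite mul0r; exact: h|split=> // v; have := h v; rewrite mul0r].
rewrite /SE_minimally_positive psd0; split=> -[h1 h2]; split=> // e e0 he.
  by apply: (h2 e e0); apply/psd.
by apply: (h2 e e0); apply/psd.
Qed.

(** Subtracting the empty diagonal changes nothing, so the empty matrix is positive definite but not
    minimal. This fits the end of the recursion, where solutions are not unique. *)
Lemma SE_hankel_seq0 a : ~ SE_minimally_positive (hankel_seq a 0).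
Proof.
move=> [[h1 h2] /(_ 1 ltr01)]; apply; split.
  by apply/is_hermitianmxP/matrixP => -[].
by move=> v; rewrite -/(qform _ v) qformE big_ord0.
Qed.

Section Transfer.
Variables (a b : nat -> C) (m : nat).
Hypotheses (a1 : 0 < a 1%N) (ab : schur_rel a b) (ra : real_below (2 * m.+1) a).

Let L : 'M[C]_(1 + m) := \matrix_(i, j) toeplitz a i j.

Definition coords (v : 'cV[C]_(1 + m)) : 'cV[C]_(1 + m) := L^T *m v.

Let a1_neq0 : a 1%N != 0. Proof. by rewrite gt_eqF. Qed.

Let L_real : L \is a realmx.
Proof.
apply/mxOverP => i j; rewrite mxE /toeplitz; case: ifP => ji; last exact: real0.
by apply: ra; have := ltn_ord i; lia.
Qed.

Let L_unit : L^T \in unitmx.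
Proof.
rewrite unitmx_tr unitmxE det_trig; last first.
  by apply/is_trig_mxP => i j ij; rewrite mxE /toeplitz leqNgt ij.
rewrite unitfE; apply/prodf_neq0 => i _; rewrite mxE /toeplitz leqnn subnn.
exact: a1_neq0.
Qed.

Lemma qform_schur v : qform (hankel_seq a m.+1) v =
  (a 1%N)^-1 * ((coords v 0 0)^* * coords v 0 0) + qform (hankel_seq b m) (dsubmx (coords v)).
Proof. by rewrite (hankel_seq_congr m a1_neq0 ab) qform_congr// qform_block. Qed.

(** Vectors with first coordinate 0 on which the form of a restricts to that of b; they transfer
    positivity from a to b. *)
Lemma coords_tail (w : 'cV[C]_m) : exists v : 'cV[C]_(1 + m),
  [/\ coords v 0 0 = 0, dsubmx (coords v) = w & v = 0 -> w = 0].
Proof.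
exists (invmx L^T *m col_mx 0 w); rewrite /coords mulKVmx//; split.
- by rewrite mxE; case: splitP => [j _|//]; rewrite mxE.
- by rewrite col_mxKd.
- move=> h; have : col_mx 0 w = L^T *m (invmx L^T *m col_mx 0 w) by rewrite mulKVmx.
  by rewrite h mulmx0 => /(congr1 dsubmx); rewrite col_mxKd => ->; apply/matrixP => i j; rewrite !mxE.
Qed.

(** The last row of the upper triangular matrix L^T has a_1 as its only nonzero entry. Therefore the
    congruence carries a southeast perturbation to a southeast perturbation, scaled by a_1^2. *)
Lemma coords_last v : coords v ord_max 0 = a 1%N * v ord_max 0.
Proof.
rewrite [LHS]mxE (bigD1 ord_max)//= big1 ?addr0.
  by rewrite !mxE /toeplitz leqnn subnn.
move=> i im; rewrite !mxE /toeplitz leqNgt.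
rewrite (_ : (i < _)%N) ?mul0r//= ltn_neqAle -ltnS ltn_ord andbT.
by apply: contra im => /eqP h; apply/eqP/val_inj.
Qed.

Lemma posdef_schur : posdef (hankel_seq a m.+1) <-> posdef (hankel_seq b m).
Proof.
have rb : real_below (2 * m) b.
  by apply: schur_real ab a1_neq0 _; rewrite -[(2 * m).+2]addn2 -(mulnDr 2 m 1) addn1.
rewrite !posdef_hankel_seq//; split=> [H w w0|H v v0].
  have [v [h0 h1 h2]] := coords_tail w.
  have := H v; rewrite qform_schur h0 mulr0 mulr0 add0r h1; apply.
  by apply: contraNneq w0 => /h2 ->.
rewrite qform_schur; have [d0|d0] := eqVneq (dsubmx (coords v)) 0; last first.
  by rewrite ltr_wpDl ?H// mulr_ge0 ?normsq_ge0// invr_ge0 ltW.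
rewrite d0 qformE big1 ?addr0; last first.
  by move=> i _; rewrite big1// => j _; rewrite !mxE mulr0.
rewrite mulr_gt0 ?invr_gt0// normsq_gt0; apply: contraNneq v0 => h0.
rewrite -(mulKmx L_unit v) -/(coords v) -(vsubmxK (coords v)) d0.
rewrite (_ : usubmx _ = 0) ?col_mx0 ?mulmx0//.
apply/matrixP => i j; rewrite !ord1 [LHS]mxE [RHS]mxE.
by rewrite (_ : lshift m 0 = 0) ?h0//; apply: val_inj.
Qed.

End Transfer.

Lemma semidef_schur a b m e : 0 < a 1%N -> schur_rel a b -> real_below (2 * m.+2) a ->
  semidef (hankel_seq a m.+2) e <-> semidef (hankel_seq b m.+1) (e / Re (a 1%N) ^+ 2).
Proof.
move=> a1 ab ra.
have a1n : a 1%N != 0 by rewrite gt_eqF.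
have a1E : a 1%N = (Re (a 1%N))%:C by apply: real_of_Im0; apply: realIm; exact: ra.
have rp : 0 < Re (a 1%N) by move: a1; rewrite {1}a1E ltcR.
have last (v : 'cV[C]_(1 + m.+1)) : dsubmx v ord_max 0 = v ord_max 0.
  by rewrite mxE; congr (v _ _); apply: val_inj.
have scal (z : C) : (e / Re (a 1%N) ^+ 2)%:C * ((a 1%N * z)^* * (a 1%N * z)) = e%:C * (z^* * z).
  have -> : (a 1%N * z)^* = a 1%N * z^*.
    by rewrite rmorphM /= conj_Creal//; exact: ra.
  rewrite rmorphM /= fmorphV rmorphXn /=. rewrite -a1E.
  by field.
split=> [H w|H v].
  have [v [h0 h1 _]] := coords_tail a1 w.
  have := H v; rewrite (qform_schur a1 ab ra) h0 mulr0 mulr0 add0r h1.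
  by rewrite -scal -(coords_last a) -last h1.
rewrite (qform_schur a1 ab ra); apply: ler_wpDl.
  by rewrite mulr_ge0 ?normsq_ge0// invr_ge0 ltW.
by have := H (dsubmx (coords a v)); rewrite last coords_last scal.
Qed.

Lemma qform_delta m (M : 'M[C]_m) i : qform M (delta_mx i 0) = M i i.
Proof.
rewrite qformE (bigD1 i)//= (bigD1 i)//= !mxE !eqxx /= conjC1 mul1r mulr1.
rewrite !big1 ?addr0// => j ji.
  by apply: big1 => k _; rewrite !mxE (negPf ji) /= conjC0 !mul0r.
by rewrite !mxE (negPf ji) mulr0.
Qed.

Lemma posdef_a1 a m : posdef (hankel_seq a m.+1) -> 0 < a 1%N.
Proof.
move=> [_ /(_ (delta_mx 0 0))]; rewrite -/(qform _ _) qform_delta mxE; apply.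
by apply/eqP => /matrixP/(_ 0 0) /eqP; rewrite !mxE !eqxx oner_eq0.
Qed.

Lemma semidef0_diag m (M : 'M[C]_m.+1) i : semidef M 0 -> 0 <= M i i.
Proof. by move=> /(_ (delta_mx i 0)); rewrite mul0r qform_delta. Qed.

Lemma SE_a1 a m : real_below (2 * m.+1) a -> SE_minimally_positive (hankel_seq a m.+1) -> 0 <= a 1%N.
Proof. by move=> ra /(SE_hankel_seq ra)[/(@semidef0_diag _ _ 0)]; rewrite mxE. Qed.

Lemma SE_hankel_seq1 a : real_below 2 a -> SE_minimally_positive (hankel_seq a 1) -> a 1%N = 0.
Proof.
move=> ra /(SE_hankel_seq (m := 0) ra)[/(@semidef0_diag _ _ 0)]; rewrite mxE /= => a1 H.
have a1E : a 1%N = (Re (a 1%N))%:C by apply: real_of_Im0; apply: realIm; exact: ra.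
apply/eqP/negPn/negP => a1n; apply: (H (Re (a 1%N))).
  by rewrite -ltcR -a1E lt_neqAle eq_sym a1n.
move=> v; rewrite -a1E qformE !big_ord1 mxE (ord1 ord_max) mulrAC mulrC.
exact: lexx.
Qed.

Lemma SE_schur a b m : 0 < a 1%N -> schur_rel a b -> real_below (2 * m.+1) a ->
  SE_minimally_positive (hankel_seq a m.+1) <-> SE_minimally_positive (hankel_seq b m).
Proof.
move=> a1 ab ra; have a1n : a 1%N != 0 by rewrite gt_eqF.
(* For m = 0 both sides are false. *)
case: m ra => [|m] ra.
  by split=> [/(SE_hankel_seq1 ra) a10|/SE_hankel_seq0//]; rewrite a10 ltxx in a1.
have rb : real_below (2 * m.+1) b.
  by apply: schur_real ab a1n _ => k kN; apply: ra; lia.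
have a1E : a 1%N = (Re (a 1%N))%:C by apply: real_of_Im0; apply: realIm; exact: ra.
have rp : 0 < Re (a 1%N) by move: a1; rewrite {1}a1E ltcR.
have r2 : 0 < Re (a 1%N) ^+ 2 by rewrite exprn_gt0.
rewrite (SE_hankel_seq ra) (SE_hankel_seq rb) (semidef_schur 0 a1 ab ra) mul0r.
split=> -[h1 h2]; split=> // e e0 he.
  apply: (h2 (e * Re (a 1%N) ^+ 2)); first by rewrite mulr_gt0.
  by apply/(semidef_schur _ a1 ab ra); rewrite mulfK// gt_eqF.
apply: (h2 (e / Re (a 1%N) ^+ 2)); first by rewrite divr_gt0.
exact/(semidef_schur _ a1 ab ra).
Qed.

(** On s e_i + e_j the form equals 2 s M_ij + M_jj, which is nonnegative for all real s only if M_ij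
    = 0. *)
Lemma semidef_zero_row m (M : 'M[C]_m.+1) i j : semidef M 0 -> 
  (forall i j, M i j \is Num.real) -> (forall i j, M i j = M j i) -> M i i = 0 -> M i j = 0.
Proof.
move=> h Mr Ms Mii; have [<-//|ij] := eqVneq i j.
have [Mij Mjj] := (Mr i j, Mr j j).
have E1 : M i j = (Re (M i j))%:C by apply: real_of_Im0; exact: realIm.
have E2 : M j j = (Re (M j j))%:C by apply: real_of_Im0; exact: realIm.
have H (s : R) : 0 <= 2 * s * Re (M i j) + Re (M j j).
  have := h (s%:C *: delta_mx i 0 + delta_mx j 0); rewrite mul0r qform_real_axis//; last first.
    by apply/complex_realP; exists s.
  rewrite Mii mulr0 add0r E1 E2 -rmorphM -rmorphMn -rmorphD ler0c /=.
  by rewrite mulr2n; lra.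
rewrite E1; apply/eqP; rewrite (_ : 0 = 0%:C)// (inj_eq (@complexI _)).
apply/negPn/negP => n0.
have := H (- (Re (M j j) + 1) / (2 * Re (M i j))).
rewrite (_ : 2 * _ * _ = - (Re (M j j) + 1)); first by lra.
by field.
Qed.

(** A zero diagonal entry kills its row, and by the Hankel structure the row contains the next
    diagonal entry as long as that is not the southeast corner. Starting from a_1 = 0 everything but
    the corner vanishes, and the corner itself vanishes by minimality. *)
Lemma SE_zero a m : real_below (2 * m.+1) a -> a 1%N = 0 ->
  SE_minimally_positive (hankel_seq a m.+1) <->
  (forall k, (0 < k)%N -> (k < 2 * m.+1)%N -> a k = 0).
Proof.
move=> ra a1; rewrite (SE_hankel_seq ra); split=> [[h1 h2]|az]; last first.
  have M0 : hankel_seq a m.+1 = 0.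
    by apply/matrixP => i j; rewrite !mxE az//; have := ltn_ord i; have := ltn_ord j; lia.
  rewrite M0; split=> [v|e e0 /(_ (delta_mx ord_max 0))]; first by rewrite mul0r qform0.
  rewrite qform0 !mxE !eqxx conjC1 !mulr1 => h; have : 0 <= - e%:C by rewrite oppr_ge0.
  by rewrite -rmorphN ler0c oppr_ge0 leNgt e0.
have row (i j : 'I_m.+1) : a (2 * i).+1 = 0 -> a (i + j).+1 = 0.
  move=> aii; have := @semidef_zero_row _ (hankel_seq a m.+1) i j h1.
  rewrite !mxE addnn -mul2n; apply=> //.
    by move=> k l; rewrite mxE; exact: hankel_seq_entry_real ra k l.
  by move=> k l; rewrite !mxE addnC.
have diag i : (i < m)%N -> a (2 * i).+1 = 0.
  elim: i => [|i IH] im; first by rewrite muln0.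
  have i1 : (i < m.+1)%N by lia.
  have [i2|i2] := ltnP i.+2 m.+1; last by lia.
  have := row (Ordinal i1) (Ordinal i2); rewrite /= => /(_ (IH (ltnW im))) <-.
  by congr a; lia.
have low k : (0 < k)%N -> (k < 2 * m.+1 - 1)%N -> a k = 0.
  move=> k0 km.
  have [km'|km'] := leqP k m.+1.
    have i0 : (k.-1 < m.+1)%N by lia.
    have := row ord0 (Ordinal i0); rewrite /= muln0 => /(_ a1) <-.
    by congr a; lia.
  have i1 : (k - m.+1 < m.+1)%N by lia.
  have := row (Ordinal i1) ord_max; rewrite /= => <-; first by congr a; lia.
  by apply: diag; lia.
have top : a (2 * m.+1 - 1)%N = 0.
  have aE : hankel_seq a m.+1 ord_max ord_max = a (2 * m.+1 - 1)%N.
    by rewrite mxE /=; congr a; lia.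
  have t0 : 0 <= a (2 * m.+1 - 1)%N by rewrite -aE; exact: semidef0_diag.
  have tE : a (2 * m.+1 - 1)%N = (Re (a (2 * m.+1 - 1)%N))%:C.
    by apply: real_of_Im0; apply: realIm; apply: ra; lia.
  apply/eqP/negPn/negP => tn; apply: (h2 (Re (a (2 * m.+1 - 1)%N))).
    by rewrite -ltcR -tE lt_neqAle eq_sym tn.
  move=> v; rewrite -tE qformE (bigD1 ord_max)//= (bigD1 ord_max)//= aE.
  rewrite !big1 ?addr0; first by rewrite mulrAC mulrC.
    move=> i im; apply: big1 => j _; rewrite mxE low ?mulr0 ?mul0r//.
    have := ltn_ord i; have := ltn_ord j; move: im; rewrite -val_eqE /=; lia.
  move=> j jm; rewrite mxE low ?mulr0 ?mul0r//.
  have := ltn_ord j; move: jm; rewrite -val_eqE /=; lia.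
move=> k k0 km; have [h|h] := ltnP k (2 * m.+1 - 1); first exact: low.
by rewrite (_ : k = 2 * m.+1 - 1)%N//; lia.
Qed.

End HankelPositivity.


(** * Degenerate data and the rank formula for a^{2m} *)

Section DegenerateExtension.
Variable R : realType.
Local Notation C := R[i].
Implicit Types (a b : nat -> C).

(* The data for which the Schur algorithm stops before step m because the
   remaining data, up to a^{2m}, vanish. *)
Inductive degenerate : nat -> (nat -> C) -> Prop :=
| DegenerateStop m a of (forall k, (0 < k)%N -> (k < 2 * m.+1 + 1)%N -> a k = 0) :
    degenerate m.+1 a
| DegenerateStep m a b of 0 < a 1%N & schur_rel a b & degenerate m b :
    degenerate m.+1 a.

Lemma schur_rel_inj a b b' : a 1%N != 0 -> schur_rel a b -> schur_rel a b' -> b' = b.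
Proof.
move=> a1 ab ab'; apply/funext => k.
exact: (schur_prefix_reduce (N := k.+1) ab ab' a1 (fun _ _ => erefl)).
Qed.

Lemma degenerate_schur m a b : 0 < a 1%N -> schur_rel a b ->
  degenerate m.+1 a <-> degenerate m b.
Proof.
move=> a1 ab; split=> [|h]; last exact: DegenerateStep a1 ab h.
move: {-1}m.+1 (erefl m.+1) => m' mE h; case: h mE a1 ab => {m' a}.
  move=> m' a az _ a1; have := az 1%N isT; rewrite addn1 ltnS.
  by move=> /(_ _); rewrite mulnS => /(_ isT) a10; rewrite a10 ltxx in a1.
move=> m' a b' _ ab' h [->] a1 ab.
by rewrite (schur_rel_inj _ ab' ab) ?gt_eqF.
Qed.

Lemma degenerate_prefix m a a' : (forall k, (k < 2 * m + 1)%N -> a' k = a k) ->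
  degenerate m a -> degenerate m a'.
Proof.
move=> aa h; elim: h a' aa => {m a} [m a az|m a b a1 ab _ IH] a' aa.
  by apply: DegenerateStop => k k0 km; rewrite aa ?az.
have a'1 : a' 1%N = a 1%N by apply: aa; lia.
have [|b' ab'] := @schur_exists R a'; first by rewrite a'1 gt_eqF.
apply: (DegenerateStep _ ab'); first by rewrite a'1.
apply: IH; apply: (schur_prefix_reduce ab ab'); first by rewrite gt_eqF.
by move=> k km; apply: aa; lia.
Qed.

(* The elimination steps of the Schur algorithm amount to a factorization
   P D P^T of the Hankel matrices, where P has r columns. *)
Lemma degenerate_LDL m a : degenerate m a ->
  exists (r : nat) (P : nat -> nat -> C) (d : nat -> C),
  [/\ (r < m)%N, (forall i k, (i < k)%N -> P i k = 0),
      (forall k, (k < r)%N -> P k k != 0), (forall k, (k < r)%N -> d k != 0)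
    & forall i j, ((i + j).+1 <= 2 * m)%N ->
        a (i + j).+1 = \sum_(k < r) P i k * d k * P j k].
Proof.
elim=> {m a} [m a az|m a b a1 ab _ [r [P [d [rm Ptrig P0 d0 bE]]]]].
  exists 0%N, (fun _ _ => 0), (fun=> 0); split=> //.
  by move=> i j ij; rewrite big_ord0 az//; lia.
have a1n : a 1%N != 0 by rewrite gt_eqF.
exists r.+1.
exists (fun i k => if k is k'.+1 then \sum_(l < i) a (i - l)%N * P l k' else a i.+1).
exists (fun k => if k is k'.+1 then d k' else (a 1%N)^-1).
split=> //.
- move=> i [//|k] ik; apply: big1 => l _; have li := ltn_ord l.
  by rewrite Ptrig ?mulr0//; lia.
- move=> [//|k] kr; rewrite big_ord_recr /= big1 ?add0r; last first.
    by move=> l _; rewrite Ptrig ?mulr0// ltn_ord.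
  by rewrite subSnn mulf_neq0// P0.
- by move=> [_|k kr]; [rewrite invr_eq0|exact: d0].
- move=> i j ij; rewrite (hankel_identity i j a1n ab) big_ord_recl /=.
  congr (_ + _); first by rewrite mulrAC.
  transitivity (\sum_(l < i) \sum_(k < r) a (i - l)%N * P l k * d k *
      (\sum_(l' < j) a (j - l')%N * P l' k)).
    apply: eq_bigr => l _; rewrite mulr_sumr.
    transitivity (\sum_(l' < j) \sum_(k < r) a (i - l)%N * P l k * d k *
        (a (j - l')%N * P l' k)).
      apply: eq_bigr => l' _; have := ltn_ord l; have := ltn_ord l' => jl il.
      rewrite bE; last by lia.
      rewrite !mulr_sumr; apply: eq_bigr => k _; ring.
    by rewrite exchange_big; apply: eq_bigr => k _; rewrite mulr_sumr.
  by rewrite exchange_big; apply: eq_bigr => k _; rewrite -!mulr_suml.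
Qed.

Definition extension_value a m r : C :=
  ((\row_(j < r) a (m + j)%N) *m invmx (hankel_seq a r) *m (\col_(i < r) a (m + i).+1)) 0 0.

(** The first r rows of P form an invertible triangular block, so P has full column rank and H_m has
    rank r. The factorization reaches one antidiagonal beyond H_m: row and column of the formula are
    q_(m-1) D P_r^T and P_r D q_m^T, with q_i the i-th row of P, and multiplying out leaves q_(m-1)
    D q_m^T = a_(2m). *)
Lemma degenerate_rank_ext m a : degenerate m a ->
  (\rank (hankel_seq a m) < m)%N /\ a (2 * m)%N = extension_value a m (\rank (hankel_seq a m)).
Proof.
move=> /degenerate_LDL[r [P [d [rm Ptrig P0 d0 aE]]]].
pose Pm n : 'M[C]_(n, r) := \matrix_(i, k) P i k.
pose D : 'M[C]_r := diag_mx (\row_k d k).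
have entry n n' (i : 'I_n) (j : 'I_n') : (Pm n *m D *m (Pm n')^T) i j =
    \sum_(k < r) P i k * d k * P j k.
  by rewrite mul_mx_diag mxE; apply: eq_bigr => k _; rewrite !mxE.
have hankE n : (n <= m)%N -> hankel_seq a n = Pm n *m D *m (Pm n)^T.
  move=> nm; apply/matrixP => i j; rewrite entry mxE aE//.
  by have := ltn_ord i; have := ltn_ord j; lia.
have Pr_unit : Pm r \in unitmx.
  rewrite unitmxE det_trig; last by apply/is_trig_mxP => i j ij; rewrite mxE Ptrig.
  by rewrite unitfE; apply/prodf_neq0 => i _; rewrite mxE P0.
have D_unit : D \in unitmx.
  by rewrite unitmxE det_diag unitfE; apply/prodf_neq0 => i _; rewrite mxE d0.
have rk : \rank (hankel_seq a m) = r.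
  pose S : 'M[C]_(m, r) := \matrix_(i, k) (i == k :> nat)%:R.
  have PS : (Pm m)^T *m S = (Pm r)^T.
    apply/matrixP => i k; rewrite !mxE.
    have km : (k < m)%N by exact: ltn_trans rm.
    rewrite (bigD1 (Ordinal km))//= !mxE eqxx mulr1 big1 ?addr0// => l lk.
    rewrite !mxE (_ : (l == k :> nat) = false) ?mulr0//.
    by apply: contraNF lk => /eqP lk; apply/eqP/val_inj.
  have free : row_free (Pm m)^T.
    apply/row_freeP; exists (S *m invmx (Pm r)^T).
    by rewrite mulmxA PS mulmxV// unitmx_tr.
  rewrite hankE// mxrankMfree// mxrankMfree ?row_free_unit//.
  by rewrite -mxrank_tr; apply/eqP.
rewrite rk; split=> //.
have -> : extension_value a m r = \sum_(k < r) P m.-1 k * d k * P m k.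
  pose q n : 'M[C]_(1, r) := \matrix_(i, k) P n k.
  have -> : extension_value a m r = (q m.-1 *m D *m (q m)^T) 0 0.
    rewrite /extension_value; congr fun_of_matrix.
    have -> : \row_(j < r) a (m + j)%N = q m.-1 *m D *m (Pm r)^T.
      apply/matrixP => i j; rewrite mul_mx_diag !mxE.
      have jr := ltn_ord j.
      rewrite (_ : (m + j)%N = (m.-1 + j).+1); last by lia.
      rewrite aE; last by lia.
      by apply: eq_bigr => k _; rewrite !mxE.
    have -> : \col_(i < r) a (m + i).+1 = Pm r *m D *m (q m)^T.
      apply/matrixP => i j; rewrite mul_mx_diag !mxE addnC.
      have ir := ltn_ord i.
      rewrite aE; last by lia.
      by apply: eq_bigr => k _; rewrite !mxE.
    rewrite hankE; last exact: ltnW.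
    set Q := Pm r in Pr_unit *; set X := q m.-1 *m D; set Y := (q m)^T.
    have PD_unit : Q *m D *m Q^T \in unitmx.
      by rewrite !unitmx_mul Pr_unit D_unit unitmx_tr.
    have -> : X *m Q^T = q m.-1 *m invmx Q *m (Q *m D *m Q^T).
      by rewrite !mulmxA mulmxKV.
    by rewrite mulmxK// -!mulmxA mulKmx.
  by rewrite mul_mx_diag mxE; apply: eq_bigr => k _; rewrite !mxE.
rewrite -aE; last by lia.
by congr a; lia.
Qed.

Lemma degenerate_SE m a : real_below (2 * m + 1) a -> degenerate m a ->
  SE_minimally_positive (hankel_seq a m).
Proof.
move=> ra h; elim: h ra => {m a} [m a az|m a b a1 ab _ IH] ra.
  have ra' : real_below (2 * m.+1) a by move=> k km; apply: ra; lia.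
  apply/(SE_zero ra'); first by apply: az; lia.
  by move=> k k0 km; apply: az; lia.
have ra' : real_below (2 * m.+1) a by move=> k km; apply: ra; lia.
apply/(SE_schur a1 ab ra'); apply: IH.
have a1n : a 1%N != 0 by rewrite gt_eqF.
by apply: (schur_real ab a1n) => k km; apply: ra; lia.
Qed.

Lemma schur_unreduce (a0 a1 : C) b : exists a, [/\ a 0%N = a0, a 1%N = a1 & schur_rel a b].
Proof.
pose G n (a : nat -> C) := match n with 0%N => a0 | 1%N => a1 | k.+2 =>
  a1 * \sum_(i < k.+1) a i.+1 * b (k - i)%N end.
have [|a aE] := @strong_rec _ 0 G.
  move=> [//|[//|n]] f g fg; rewrite /G; congr (_ * _); apply: eq_bigr => i _.
  by have := ltn_ord i => ?; rewrite fg//; lia.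
exists a; split; first by rewrite aE.
  by rewrite aE.
by move=> k; rewrite aE /= (aE 1%N).
Qed.

(** The open value a_(2m) is fixed by reducing until the remaining data vanish, continuing these by
    zeros and undoing the reduction steps. *)
Lemma SE_degenerate m a : real_below (2 * m) a -> SE_minimally_positive (hankel_seq a m) ->
  exists2 a', (forall k, (k < 2 * m)%N -> a' k = a k) & degenerate m a'.
Proof.
elim: m a => [a _ /SE_hankel_seq0//|m IH] a ra sa.
have := SE_a1 ra sa; rewrite le_eqVlt => /orP[/eqP a1|a1].
  have az := (SE_zero ra (esym a1)).1 sa.
  exists (fun k => if (k < 2 * m.+1)%N then a k else 0); first by move=> k ->.
  by apply: DegenerateStop => k k0 _; case: ifP => // km; exact: az.
have a1n : a 1%N != 0 by rewrite gt_eqF.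
have [b ab] := schur_exists a1n.
have rb : real_below (2 * m) b.
  by apply: (schur_real ab a1n) => k km; apply: ra; lia.
have [b' bb hb'] := IH b rb ((SE_schur a1 ab ra).1 sa).
have [a' [a'0 a'1 ab']] := schur_unreduce (a 0%N) (a 1%N) b'.
exists a'; last by apply: (DegenerateStep _ ab' hb'); rewrite a'1.
move=> k km; apply: (schur_prefix_augment ab ab' a'0 a'1 bb); lia.
Qed.

(* As the rank is less than m, the formula for a^{2m} only involves earlier
   data, so it is enough to compare a with one degenerate continuation. *)
Lemma degenerateP m a : real_below (2 * m + 1) a -> degenerate m a <->
  SE_minimally_positive (hankel_seq a m) /\ a (2 * m)%N = extension_value a m (\rank (hankel_seq a m)).
Proof.
move=> ra; split=> [h|[sa aE]].
  by split; [exact: degenerate_SE|have [] := degenerate_rank_ext h].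
have ra' : real_below (2 * m) a by move=> k km; apply: ra; lia.
have [a' aa ha'] := SE_degenerate ra' sa.
apply: (degenerate_prefix _ ha') => k; rewrite addn1 ltnS leq_eqVlt => /orP[/eqP ->|/aa//].
have [rk ->] := degenerate_rank_ext ha'.
have hE n : (n <= m)%N -> hankel_seq a' n = hankel_seq a n.
  move=> nm; apply/matrixP => i j; rewrite !mxE aa//.
  by have := ltn_ord i; have := ltn_ord j; lia.
rewrite aE; rewrite hE// in rk *.
rewrite /extension_value hE; last exact: ltnW.
congr ((_ *m _ *m _) _ _); apply/matrixP => i j; rewrite !mxE aa//.
  by have := ltn_ord j; lia.
by have := ltn_ord i; lia.
Qed.

End DegenerateExtension.

(** * Solvability and uniqueness by recursion on the data *)

Section Solvability.
Variable R : realType.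
Local Notation C := R[i].
Implicit Types (a b : nat -> C) (x : R).

Lemma taylor_cst_fun x (y : C) : taylor x (fun=> y) (fun k => if k == 0%N then y else 0).
Proof.
exists (fun=> y); split=> //; last exact: expands_cst.
by apply/dnear_modulusP; exists 1 => [|w _ _]; [exact: ltr01|exact: (analytic_cst y w)].
Qed.

Lemma taylor_solution_cst N x a (y : C) : 0 <= Im y ->
  (forall k, (k < N)%N -> a k = if k == 0%N then y else 0) -> taylor_solution N x a (fun=> y).
Proof.
move=> y0 ha; split=> [z _|].
  by split; [exact: (analytic_cst y z)|].
by exists (fun k => if k == 0%N then y else 0) => [|k /ha]; first exact: taylor_cst_fun.
Qed.

(** A second solution, besides the constant one, when only a real a_0 is prescribed. *)
Lemma taylor_solution_translate N x a (y : C) : Im y = 0 -> (N <= 1)%N -> a 0%N = y ->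
  taylor_solution N x a (fun z => y + (z - x%:C)).
Proof.
move=> y0 N1 ay.
have an z : analytic_at (fun w => y + (w - x%:C)) z.
  apply: analyticD; first exact: (analytic_cst y z).
  by apply: analyticB; [exact: analytic_id|exact: (analytic_cst x%:C z)].
split=> [z z0|].
  by split; [exact: an|rewrite Im_add y0 add0r Im_shift; exact: ltW].
have [c c0 hc] := (analytic_atP _ _).1 (an x%:C).
exists c.
  exists (fun z => y + (z - x%:C)); split=> //.
  by apply/dnear_modulusP; exists 1 => [|w _ _]; [exact: ltr01|exact: an].
move=> [|k] kN; first by rewrite c0 subrr addr0 ay.
by have := leq_trans kN N1.
Qed.

Lemma taylor_solution_dichotomy N x a f : Im (a 0%N) = 0 -> taylor_solution N.+2 x a f ->
  0 < a 1%N \/ (forall k, (0 < k)%N -> (k < N.+2)%N -> a k = 0) /\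
               (forall z, 0 < Im z -> f z = a 0%N).
Proof.
move=> a0 [hf [c hc ca]].
have c0 : c 0%N = a 0%N by exact: ca.
have [|cz|c1] := taylor_coef1 hf hc; first by rewrite c0.
  right; split=> [k k0 kN|z z0]; first by rewrite -ca// cz.
  by rewrite (taylor_cst hf hc cz)// c0.
by left; rewrite -ca.
Qed.

(** With a_1 = 0 the constant a_0 is the only candidate, so solvability already entails
    uniqueness. *)
Lemma taylor_solution_coef1_zero N x a : Im (a 0%N) = 0 -> a 1%N = 0 ->
  ((exists f, taylor_solution N.+2 x a f) <-> (forall k, (0 < k)%N -> (k < N.+2)%N -> a k = 0)) /\
  (taylor_unique N.+2 x a <-> (forall k, (0 < k)%N -> (k < N.+2)%N -> a k = 0)).
Proof.
move=> a0 a1.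
have nec f : taylor_solution N.+2 x a f -> (forall k, (0 < k)%N -> (k < N.+2)%N -> a k = 0) /\
    (forall z, 0 < Im z -> f z = a 0%N).
  by move=> /(taylor_solution_dichotomy a0)[|//]; rewrite a1 ltxx.
have suf : (forall k, (0 < k)%N -> (k < N.+2)%N -> a k = 0) ->
    taylor_solution N.+2 x a (fun=> a 0%N).
  by move=> az; apply: taylor_solution_cst => [|[//|k] kN]; rewrite ?a0//= az.
split; split=> [[f hf]|az].
- exact: (nec f hf).1.
- by exists (fun=> a 0%N); exact: suf.
- by move=> _; exact: (nec f hf).1.
- by exists (fun=> a 0%N) => [|g /nec[_]//]; exact: suf.
Qed.

Lemma posdef_hankel_seq0 a : posdef (hankel_seq a 0).
Proof. by apply/posdef_hankel_seq => // v; rewrite (flatmx0 v) eqxx. Qed.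

(** Induction on the first nonreal index k in steps of two. It ends at k = 0, where a solution is
    constructed, or at k = 1, where a_1 would have to be real; so odd k admit no solution and no
    m. *)
Lemma taylor_solution_nonreal N x a k : real_below k a -> (k < N)%N -> Im (a k) != 0 ->
  (exists f, taylor_solution N x a f) <->
  exists m, [/\ k = (2 * m)%N, posdef (hankel_seq a m) & 0 < Im (a k)].
Proof.
elim/ltn_ind: k N a => -[|[|k]] IH N a ra kN ak.
- split=> [[f [hf [c hc ca]]]|[m [_ _ a0]]]; last exact: interior_taylor_solution.
  exists 0%N; split=> //; first exact: posdef_hankel_seq0.
  rewrite lt_neqAle eq_sym ak /= -ca//; exact: taylor_Im0_ge0 hf hc.
- split=> [[f hf]|[m [km]]]; last by lia.
  case: N kN hf => [//|[//|N]] _ /(taylor_solution_dichotomy (realIm (ra 0%N isT)))[a1|[az _]].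
    by move: ak; rewrite ((complex_gt0P _).1 a1).1 eqxx.
  by move: ak; rewrite az// eqxx.
- case: N kN => [//|[//|N]] kN.
  have a0 := realIm (ra 0%N isT).
  have key (a1 : 0 < a 1%N) : (exists f, taylor_solution N.+2 x a f) <->
      exists m, [/\ k.+2 = (2 * m)%N, posdef (hankel_seq a m) & 0 < Im (a k.+2)].
    have a1n : a 1%N != 0 by rewrite gt_eqF.
    have [b ab] := schur_exists a1n.
    have rb := schur_real ab a1n ra.
    have Imb := schur_Im ab ra rb.
    have r1 : 0 < Re (a 1%N) ^+ 2 by rewrite exprn_gt0// ((complex_gt0P _).1 a1).2.
    rewrite (taylor_solvable_schur N x a0 a1 ab) (IH k _ N b rb)//; last first.
      by apply: contraNneq ak => b0; rewrite Imb b0 mulr0.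
    rewrite Imb pmulr_rgt0//; split=> -[m [km pd kI]].
      exists m.+1; split=> //; first by lia.
      by apply/(posdef_schur a1 ab) => //; move=> j jm; apply: ra; lia.
    case: m km pd => [|m] km pd; first by lia.
    exists m; split=> //; first by lia.
    by apply/(posdef_schur a1 ab) => //; move=> j jm; apply: ra; lia.
  split=> [[f hf]|[m [km pd kI]]].
    have [a1|[az _]] := taylor_solution_dichotomy a0 hf; first by apply/(key a1); exists f.
    by move: ak; rewrite az// eqxx.
  case: m km pd => [|m] km pd; first by lia.
  apply/(key (posdef_a1 pd)); by exists m.+1.
Qed.

Lemma not_taylor_unique0 x a : ~ taylor_unique 0 x a.
Proof.
move=> [f _ uni].
have i0 : 0 < Im ('i : C) by exact: ltr01.
have s0 : taylor_solution 0 x a (fun=> 0) by apply: taylor_solution_cst => /=.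
have s1 : taylor_solution 0 x a (fun=> 'i) by apply: taylor_solution_cst => //; exact: ltW.
have := uni _ s0 'i i0; rewrite -(uni _ s1 'i i0) => /eqP.
by rewrite eq_sym (negPf (upper_neq0 i0)).
Qed.

Lemma not_taylor_unique1 x a : Im (a 0%N) = 0 -> ~ taylor_unique 1 x a.
Proof.
move=> a0 [f _ uni].
have xi0 : 0 < Im (x%:C + 'i : C) by rewrite Im_real_shift; exact: ltr01.
have s0 : taylor_solution 1 x a (fun=> a 0%N) by apply: taylor_solution_cst => [|[]//]; rewrite a0.
have s1 := taylor_solution_translate x a0 (leqnn 1) (erefl (a 0%N)).
have := uni _ s0 _ xi0; rewrite -(uni _ s1 _ xi0) (addrC x%:C) addrK => /eqP.
have i0 : 0 < Im ('i : C) by exact: ltr01.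
by rewrite eq_sym -subr_eq0 addrC addKr (negPf (upper_neq0 i0)).
Qed.

Lemma not_taylor_solution_neg N x a : Im (a 0%N) = 0 -> ~ 0 <= a 1%N -> ~ exists f, taylor_solution N.+2 x a f.
Proof.
move=> a0 a1 [f /(taylor_solution_dichotomy a0)[/ltW//|[az _]]].
by apply: a1; rewrite az.
Qed.

Lemma taylor_unique_taylor_solution N x a : taylor_unique N x a -> exists f, taylor_solution N x a f.
Proof. by move=> [f hf _]; exists f. Qed.

(** Odd refers to n = 2m - 1, that is, to 2m Taylor conditions. For m = 0 no condition is left and
    uniqueness fails. *)
Lemma taylor_solution_real_odd m x a : real_below (2 * m) a ->
  ((exists f, taylor_solution (2 * m) x a f) <->
   posdef (hankel_seq a m) \/ SE_minimally_positive (hankel_seq a m)) /\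
  (taylor_unique (2 * m) x a <-> SE_minimally_positive (hankel_seq a m)).
Proof.
elim: m a => [|m IH] a ra.
  rewrite muln0; split; split.
  - by move=> _; left; exact: posdef_hankel_seq0.
  - by move=> _; exists (fun=> 0); apply: taylor_solution_cst => /=.
  - by move=> /not_taylor_unique0.
  - by move=> /SE_hankel_seq0.
have N2 : (2 * m.+1 = (2 * m).+2)%N by lia.
have a0 : Im (a 0%N) = 0 by apply: realIm; apply: ra; lia.
have [a1|a1n] := pselect (0 <= a 1%N); last first.
  have no : ~ exists f, taylor_solution (2 * m.+1) x a f by rewrite N2; exact: not_taylor_solution_neg.
  have nSE : ~ SE_minimally_positive (hankel_seq a m.+1) by move=> /(SE_a1 ra).
  split; split=> //; first by case=> [/posdef_a1/ltW|].
  by move=> /taylor_unique_taylor_solution.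
move: a1; rewrite le_eqVlt => /orP[/eqP/esym a1|a1].
  rewrite N2; have [-> ->] := taylor_solution_coef1_zero (2 * m) x a0 a1.
  rewrite -N2 (SE_zero ra a1); split; split=> //; first by right.
  by case=> // /posdef_a1; rewrite a1 ltxx.
have [|b ab] := @schur_exists R a; first by rewrite gt_eqF.
have rb : real_below (2 * m) b.
  by apply: (schur_real ab) => [|k km]; [rewrite gt_eqF|apply: ra; lia].
have [h1 h2] := IH b rb.
rewrite (posdef_schur a1 ab ra) (SE_schur a1 ab ra) -h1 -h2 N2.
by rewrite (taylor_solvable_schur _ x a0 a1 ab) (taylor_unique_schur _ x a0 a1 ab).
Qed.

(** For n = 2m the recursion ends with the single condition on a_0. Stated with [degenerate], the
    criterion passes through a reduction step unchanged. *)
Lemma taylor_solution_real_even m x a : real_below (2 * m + 1) a ->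
  ((exists f, taylor_solution (2 * m + 1) x a f) <-> posdef (hankel_seq a m) \/ degenerate m a) /\
  (taylor_unique (2 * m + 1) x a <-> degenerate m a).
Proof.
elim: m a => [|m IH] a ra.
  have a0 := realIm (ra 0%N isT); rewrite muln0 add0n; split; split.
  - by move=> _; left; exact: posdef_hankel_seq0.
  - by move=> _; exists (fun=> a 0%N); apply: taylor_solution_cst => [|[]//]; rewrite a0.
  - by move=> /(not_taylor_unique1 a0).
  - by move=> h; inversion h.
have N2 : (2 * m.+1 + 1 = (2 * m + 1).+2)%N by lia.
have a0 : Im (a 0%N) = 0 by apply: realIm; apply: ra; lia.
have ra' : real_below (2 * m.+1) a by move=> k km; apply: ra; lia.
have [a1|a1n] := pselect (0 <= a 1%N); last first.
  have no : ~ exists f, taylor_solution (2 * m.+1 + 1) x a f by rewrite N2; exact: not_taylor_solution_neg.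
  have nd : ~ degenerate m.+1 a by move=> /(degenerate_SE ra)/(SE_a1 ra').
  split; split=> //; first by case=> [/posdef_a1/ltW|].
  by move=> /taylor_unique_taylor_solution.
move: a1; rewrite le_eqVlt => /orP[/eqP/esym a1|a1].
  have dz : degenerate m.+1 a <->
      (forall k, (0 < k)%N -> (k < 2 * m.+1 + 1)%N -> a k = 0).
    split=> [h|]; last exact: DegenerateStop.
    by inversion h as [? ? az|? ? b a1']; [|move: a1'; rewrite a1 ltxx].
  rewrite N2; have [-> ->] := taylor_solution_coef1_zero (2 * m + 1) x a0 a1.
  rewrite -N2 dz; split; split=> //; first by right.
  by case=> // /posdef_a1; rewrite a1 ltxx.
have [|b ab] := @schur_exists R a; first by rewrite gt_eqF.
have rb : real_below (2 * m + 1) b.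
  by apply: (schur_real ab) => [|k km]; [rewrite gt_eqF|apply: ra; lia].
have [h1 h2] := IH b rb.
rewrite (posdef_schur a1 ab ra') (degenerate_schur _ a1 ab) -h1 -h2 N2.
by rewrite (taylor_solvable_schur _ x a0 a1 ab) (taylor_unique_schur _ x a0 a1 ab).
Qed.

Lemma rho_SomeP (a : seq C) k : rho a = Some k ->
  [/\ (k.+1 < size a)%N, Im (term a k) != 0 & real_below k (term a)].
Proof.
rewrite /rho; set s := map _ _; case: ifP => // hs [<-].
have ss : size s = (size a).-1 by rewrite size_map size_behead.
have kS : (find id s < size s)%N by rewrite -has_find.
have sE j : (j < size s)%N -> nth false s j = (Im (term a j) != 0).
  by rewrite ss => js; rewrite (nth_map 0) ?size_behead// nth_behead.
split; first by move: kS; rewrite ss; lia.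
  by rewrite -sE//; exact: (nth_find false hs).
move=> j jk; apply: Im_real; apply/eqP/negPn; rewrite -sE ?(ltn_trans jk)//.
by have /= -> := before_find false jk.
Qed.

Lemma rho_NoneP (a : seq C) : rho a = None -> real_below (size a).-1 (term a).
Proof.
rewrite /rho; set s := map _ _; case: ifP => // /negbT hs _ j js.
apply: Im_real; apply/eqP; move: hs; rewrite has_map -all_predC => /all_nthP h.
have := h 0 j; rewrite size_behead nth_behead => /(_ js) /=.
by move=> /negPn.
Qed.

End Solvability.

Unset Implicit Arguments.

Theorem theorem1p2 (R : realType) (n : nat) (hn : (1 <= n)%N) (x : R)
    (a : (n.+2).-tuple R[i])
    (ha_real : complex.Im a`_0 = 0) (ha_le0 : complex.Re a`_0 <= 0)
    (ha0 : 0 <= complex.Im (term a 0)) :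
  [/\ (forall k : nat, rho a = Some k -> odd k -> ~ solvable x a),
      (forall m : nat, rho a = Some (2 * m)%N ->
         (solvable x a <->
          posdef (hankel a m) /\ 0 < complex.Im (term a (2 * m)))),
      (forall m : nat, rho a = None -> n = (2 * m - 1)%N ->
         (solvable x a <->
          posdef (hankel a m) \/ SE_minimally_positive (hankel a m)) /\
         (uniquely_solvable x a <-> SE_minimally_positive (hankel a m)))
    & (forall m : nat, rho a = None -> n = (2 * m)%N ->
         (solvable x a <->
          posdef (hankel a m) \/
          (SE_minimally_positive (hankel a m) /\
           term a n = hankel_extension a m)) /\
         (uniquely_solvable x a <->
          SE_minimally_positive (hankel a m) /\
          term a n = hankel_extension a m))].
Proof.
have sa : size a = n.+2 by rewrite size_tuple.
have solvE := solvableE x sa ha_real ha_le0 ha0.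
have uniqE := uniquely_solvableE x sa ha_real ha_le0 ha0.
split.
- move=> k /rho_SomeP[ka kI rk] kodd.
  rewrite sa ltnS in ka.
  rewrite solvE (taylor_solution_nonreal x rk ka kI) => -[m [km _ _]].
  by rewrite km mul2n odd_double in kodd.
- move=> m /rho_SomeP[ka kI rk]; rewrite sa ltnS in ka.
  rewrite solvE (taylor_solution_nonreal x rk ka kI); split=> [[m' [km pd Ik]]|[pd Ik]].
    have mm : m = m' by lia.
    by rewrite -mm in pd; split.
  by exists m.
- move=> m /rho_NoneP; rewrite sa /= => ra nm.
  (* The subtraction is truncated: m = 0 would give n = 0, which [hn] excludes. *)
  have N2 : n.+1 = (2 * m)%N by lia.
  by rewrite solvE uniqE; have := @taylor_solution_real_odd R m x (term a); rewrite -N2; apply.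
- move=> m /rho_NoneP; rewrite sa /= => ra nm.
  have N2 : n.+1 = (2 * m + 1)%N by lia.
  have := @taylor_solution_real_even R m x (term a); have := @degenerateP R m (term a).
  rewrite -N2 -nm => /(_ ra) dE /(_ ra)[h1 h2].
  by rewrite solvE uniqE h1 h2 dE.
Qed.
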